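(* Let $\mathcal{G}$ be any ultragraph and let $R$ be any commutative unital ring. Then there exists a graph $E$ such that the Leavitt path algebra $L_R(\mathcal{G})$ is Morita equivalent (as a ring) to the Leavitt path algebra $L_R(E)$.
   Context: Algebras over the commutative unital ring $R$ are associative and not necessarily unital. Graph: $E=(E^0,E^1,r_E,s_E)$ with countable sets $E^0$ (vertices), $E^1$ (edges) and maps $r_E,s_E:E^1\to E^0$. A Leavitt $E$-family in an $R$-algebra $\mathcal{A}$ is a set $\{Q_v,T_e,T_{e^*}\}_{v\in E^0,e\in E^1}\subseteq\mathcal{A}$ with (LP1) $Q_vQ_w=\delta_{v,w}Q_v$; (LP2) $Q_{s_E(e)}T_e=T_eQ_{r_E(e)}=T_e$ and $Q_{r_E(e)}T_{e^*}=T_{e^*}Q_{s_E(e)}=T_{e^*}$; (LP3) $T_{e^*}T_f=\delta_{e,f}Q_{r_E(e)}$; (LP4) $Q_v=\sum_{e\in s_E^{-1}(v)}T_eT_{e^*}$ whenever $0<|s_E^{-1}(v)|<\infty$. $L_R(E)$ is the $R$-algebra generated by a universal Leavitt $E$-family $\{q_v,t_e,t_{e^*}\}$: for every Leavitt $E$-family $\{Q_v,T_e,T_{e^*}\}$ in an $R$-algebra $\mathcal{A}$ there is an $R$-algebra homomorphism $L_R(E)\to\mathcal{A}$ with $q_v\mapsto Q_v$, $t_e\mapsto T_e$, $t_{e^*}\mapsto T_{e^*}$. Ultragraph: $\mathcal{G}=(G^0,\mathcal{G}^1,r,s)$ with countable sets $G^0$ (vertices), $\mathcal{G}^1$ (edges),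 a source map $s:\mathcal{G}^1\to G^0$ and a range map $r:\mathcal{G}^1\to\mathcal{P}(G^0)\setminus\{\emptyset\}$. $\mathcal{G}^0$ is the smallest subset of $\mathcal{P}(G^0)$ containing $\{v\}$ for all $v\in G^0$ and $r(e)$ for all $e\in\mathcal{G}^1$ and closed under finite unions, finite intersections and relative complements. A Leavitt $\mathcal{G}$-family in an $R$-algebra $\mathcal{A}$ is a set $\{P_A,S_e,S_{e^*}\}_{A\in\mathcal{G}^0,e\in\mathcal{G}^1}\subseteq\mathcal{A}$ with (uLP1) $P_\emptyset=0$, $P_{A\cap B}=P_AP_B$, $P_{A\cup B}=P_A+P_B-P_{A\cap B}$; (uLP2) $P_{s(e)}S_e=S_eP_{r(e)}=S_e$ and $P_{r(e)}S_{e^*}=S_{e^*}P_{s(e)}=S_{e^*}$; (uLP3) $S_{e^*}S_f=\delta_{e,f}P_{r(e)}$; (uLP4) $P_v=\sum_{e\in s^{-1}(v)}S_eS_{e^*}$ whenever $0<|s^{-1}(v)|<\infty$ (where $P_v:=P_{\{v\}}$). $L_R(\mathcal{G})$ is the $R$-algebra generated by a universal Leavitt $\mathcal{G}$-family $\{p_A,s_e,s_{e^*}\}$ (same universal property). Morita equivalence: for a ring $S$ (not necessarily unital), $S\text{-}MOD$ is the full subcategory of left $S$-modules $M$ which are unital ($SM=M$) and nondegenerate ($Sx=\{0\}\Rightarrow x=0$). Rings $S,S'$ are Morita equivalent if the categories $S\text{-}MOD$ and $S'\text{-}MOD$ are equivalent. *)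

(* Defs.v *)
From HB Require Import structures.
From mathcomp Require Import all_boot all_order all_algebra.
From mathcomp Require Import boolp classical_sets functions cardinality fsbigop.

Set Implicit Arguments.
Unset Strict Implicit.
Unset Printing Implicit Defensive.

Import GRing.Theory.

Local Open Scope classical_set_scope.
Local Open Scope ring_scope.
Local Open Scope quotient_scope.

HB.mixin Record Zmodule_isRng S of GRing.Zmodule S := {
  rng_mul : S -> S -> S;
  rng_mulA : associative rng_mul;
  rng_mulDl : left_distributive rng_mul +%R;
  rng_mulDr : right_distributive rng_mul +%R
}.

#[short(type="rngType")]
HB.structure Definition Rng := {S of Zmodule_isRng S & GRing.Zmodule S}.

Notation "x ** y" := (rng_mul x y) (at level 40, left associativity) : ring_scope.

HB.mixin Record Rng_isRngAlgebra (R : pzRingType) A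
    of Rng A & GRing.Lmodule R A := {
  rng_scaleAl : forall (a : R) (x y : A), a *: (x ** y) = (a *: x) ** y;
  rng_scaleAr : forall (a : R) (x y : A), a *: (x ** y) = x ** (a *: y)
}.

#[short(type="rngAlgType")]
HB.structure Definition RngAlgebra (R : pzRingType) :=
  {A of Rng_isRngAlgebra R A & Rng A & GRing.Lmodule R A}.

Definition alg_hom (R : pzRingType) (A B : rngAlgType R) (f : A -> B) : Prop :=
  linear f /\ {morph f : x y / x ** y}.

HB.mixin Record Zmodule_isRngModule (S : rngType) M of GRing.Zmodule M := {
  rng_act : S -> M -> M;
  rng_actA : forall (a b : S) (m : M), rng_act (a ** b) m = rng_act a (rng_act b m);
  rng_actDl : forall (a b : S) (m : M), rng_act (a + b) m = rng_act a m + rng_act b m;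
  rng_actDr : forall (a : S) (m n : M), rng_act a (m + n) = rng_act a m + rng_act a n
}.

#[short(type="rngModType")]
HB.structure Definition RngModule (S : rngType) :=
  {M of Zmodule_isRngModule S M & GRing.Zmodule M}.

Notation "a *> m" := (rng_act a m) (at level 40, left associativity) : ring_scope.

Record category := Category {
  obj :> Type;
  mor : obj -> obj -> Type;
  idm : forall X, mor X X;
  compm : forall X Y Z, mor Y Z -> mor X Y -> mor X Z;
  compmA : forall X Y Z W (h : mor Z W) (g : mor Y Z) (f : mor X Y),
    compm h (compm g f) = compm (compm h g) f;
  comp1m : forall X Y (f : mor X Y), compm (idm Y) f = f;
  compm1 : forall X Y (f : mor X Y), compm f (idm X) = f
}.
Arguments mor {c} X Y.
Arguments idm {c} X.
Arguments compm {c X Y Z} g f.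

Record functor (C D : category) := Functor {
  fobj :> C -> D;
  fmap : forall X Y : C, mor X Y -> mor (fobj X) (fobj Y);
  fmap_id : forall X : C, fmap (idm X) = idm (fobj X);
  fmap_comp : forall (X Y Z : C) (g : mor Y Z) (f : mor X Y),
    fmap (compm g f) = compm (fmap g) (fmap f)
}.
Arguments fmap {C D} f0 {X Y} f.

Definition functor_id (C : category) : functor C C :=
  @Functor C C id (fun _ _ f => f) (fun _ => erefl) (fun _ _ _ _ _ => erefl).

Definition functor_comp (C D B : category) (G : functor D B) (F : functor C D) :
  functor C B.
Proof.
apply: (@Functor C B (fun X => G (F X)) (fun _ _ f => fmap G (fmap F f))).
- by move=> X; rewrite !fmap_id.
- by move=> X Y Z g f; rewrite !fmap_comp.
Defined.

Record nat_iso (C D : category) (F G : functor C D) := NatIso {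
  nat_to : forall X : C, mor (F X) (G X);
  nat_from : forall X : C, mor (G X) (F X);
  nat_toK : forall X, compm (nat_from X) (nat_to X) = idm (F X);
  nat_fromK : forall X, compm (nat_to X) (nat_from X) = idm (G X);
  nat_to_natural : forall (X Y : C) (f : mor X Y),
    compm (nat_to Y) (fmap F f) = compm (fmap G f) (nat_to X)
}.

Definition equivalent_categories (C D : category) : Prop :=
  exists (F : functor C D) (G : functor D C),
    inhabited (nat_iso (functor_comp G F) (functor_id C)) /\
    inhabited (nat_iso (functor_comp F G) (functor_id D)).

Section Modules.
Variable S : rngType.

(* S M is the additive subgroup generated by the products a *> m. *)
Definition unital_module (M : rngModType S) : Prop :=
  forall x : M, exists s : seq (S * M), x = \sum_(p <- s) p.1 *> p.2.

Definition nondegenerate_module (M : rngModType S) : Prop :=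
  forall x : M, (forall a : S, a *> x = 0) -> x = 0.

Record MOD_obj := MODObj {
  MOD_module :> rngModType S;
  MOD_unital : unital_module MOD_module;
  MOD_nondegenerate : nondegenerate_module MOD_module
}.

Record module_hom (M N : rngModType S) := ModuleHom {
  module_fun :> M -> N;
  module_homD : {morph module_fun : x y / x + y};
  module_homZ : forall (a : S) (x : M), module_fun (a *> x) = a *> module_fun x
}.

Lemma module_hom_ext (M N : rngModType S) (f g : module_hom M N) :
  f =1 g -> f = g.
Proof.
case: f g => [f fD fZ] [g gD gZ] /= /funext fg.
by case: _ / fg in gD gZ *; congr ModuleHom; exact: Prop_irrelevance.
Qed.

Definition module_id (M : rngModType S) : module_hom M M :=
  @ModuleHom M M id (fun _ _ => erefl) (fun _ _ => erefl).

Definition module_comp (M N P : rngModType S)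
  (g : module_hom N P) (f : module_hom M N) : module_hom M P.
Proof.
apply: (@ModuleHom M P (fun x => g (f x))).
- by move=> x y; rewrite !module_homD.
- by move=> a x; rewrite !module_homZ.
Defined.

Definition MOD : category.
Proof.
apply: (@Category MOD_obj module_hom module_id
  (fun M N P : MOD_obj => @module_comp M N P)).
- by move=> X Y Z W h g f; exact: module_hom_ext.
- by move=> X Y f; exact: module_hom_ext.
- by move=> X Y f; exact: module_hom_ext.
Defined.

End Modules.

Definition morita_equivalent (S S' : rngType) : Prop :=
  equivalent_categories (MOD S) (MOD S').

(* Given a class [P] of families [X -> A] in R-algebras [A], [univ_alg P] is
  the set of non-unital R-algebra terms over [X], two terms being identified
  when every family of the class gives them the same value.  It is generated
  by [univ_gen] ([univ_ind]), and every family of the class factors through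
  [univ_gen] ([univ_lift]); that [univ_gen] itself belongs to the class is
  proved below for each kind of Leavitt family. *)

Section UniversalAlgebra.
Variables (R : comPzRingType) (X : Type).
Variable P : forall A : rngAlgType R, (X -> A) -> Prop.

Inductive term :=
  | TGen of X
  | TZero
  | TAdd of term & term
  | TOpp of term
  | TScale of R & term
  | TMul of term & term.

HB.instance Definition _ := gen_eqMixin term.
HB.instance Definition _ := gen_choiceMixin term.

Fixpoint eval (A : rngAlgType R) (f : X -> A) (t : term) : A :=
  match t with
  | TGen x => f x
  | TZero => 0
  | TAdd t u => eval f t + eval f u
  | TOpp t => - eval f t
  | TScale a t => a *: eval f t
  | TMul t u => eval f t ** eval f u
  end.

Definition term_eq (t u : term) : bool :=
  `[< forall (A : rngAlgType R) (f : X -> A), P f -> eval f t = eval f u >].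

Lemma term_eq_refl : reflexive term_eq.
Proof. by move=> t; apply/asboolP. Qed.

Lemma term_eq_sym : symmetric term_eq.
Proof.
by move=> t u; apply/asboolP/asboolP => tu A f Pf; rewrite (tu A f Pf).
Qed.

Lemma term_eq_trans : transitive term_eq.
Proof.
move=> u t v /asboolP tu /asboolP uv; apply/asboolP => A f Pf.
by rewrite (tu A f Pf) (uv A f Pf).
Qed.

Canonical term_eq_equiv :=
  EquivRel term_eq term_eq_refl term_eq_sym term_eq_trans.

Definition univ_alg : Type := {eq_quot term_eq}.

HB.instance Definition _ := Choice.on univ_alg.
HB.instance Definition _ := EqQuotient.on univ_alg.

Definition univ_eval (A : rngAlgType R) (f : X -> A) (x : univ_alg) : A :=
  eval f (repr x).

Lemma univ_evalE (A : rngAlgType R) (f : X -> A) (t : term) :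
  P f -> univ_eval f (\pi_univ_alg t) = eval f t.
Proof.
move=> Pf; rewrite /univ_eval; have : term_eq (repr (\pi_univ_alg t)) t.
  by rewrite -eqmodE reprK.
by move=> /asboolP /(_ A f Pf).
Qed.

Lemma univ_eqP (x y : univ_alg) :
  (forall (A : rngAlgType R) (f : X -> A), P f -> univ_eval f x = univ_eval f y) ->
  x = y.
Proof.
by move=> xy; rewrite -[x]reprK -[y]reprK; apply/eqmodP/asboolP.
Qed.

Definition univ_zero : univ_alg := \pi_univ_alg TZero.
Definition univ_add (x y : univ_alg) : univ_alg := \pi_univ_alg (TAdd (repr x) (repr y)).
Definition univ_opp (x : univ_alg) : univ_alg := \pi_univ_alg (TOpp (repr x)).
Definition univ_scale (a : R) (x : univ_alg) : univ_alg := \pi_univ_alg (TScale a (repr x)).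
Definition univ_mul (x y : univ_alg) : univ_alg := \pi_univ_alg (TMul (repr x) (repr y)).
Definition univ_gen (x : X) : univ_alg := \pi_univ_alg (TGen x).

Section Eval.
Variables (A : rngAlgType R) (f : X -> A).
Hypothesis Pf : P f.
Lemma univ_eval0 : univ_eval f univ_zero = 0.
Proof. exact: univ_evalE. Qed.
Lemma univ_evalD x y : univ_eval f (univ_add x y) = univ_eval f x + univ_eval f y.
Proof. exact: univ_evalE. Qed.
Lemma univ_evalN x : univ_eval f (univ_opp x) = - univ_eval f x.
Proof. exact: univ_evalE. Qed.
Lemma univ_evalZ a x : univ_eval f (univ_scale a x) = a *: univ_eval f x.
Proof. exact: univ_evalE. Qed.
Lemma univ_evalM x y : univ_eval f (univ_mul x y) = univ_eval f x ** univ_eval f y.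
Proof. exact: univ_evalE. Qed.
Lemma univ_eval_gen x : univ_eval f (univ_gen x) = f x.
Proof. exact: univ_evalE. Qed.
End Eval.

Lemma univ_addA : associative univ_add.
Proof. by move=> x y z; apply: univ_eqP => A f Pf; rewrite !univ_evalD // addrA. Qed.
Lemma univ_addC : commutative univ_add.
Proof. by move=> x y; apply: univ_eqP => A f Pf; rewrite !univ_evalD // addrC. Qed.
Lemma univ_add0 : left_id univ_zero univ_add.
Proof.
by move=> x; apply: univ_eqP => A f Pf; rewrite univ_evalD // univ_eval0 // add0r.
Qed.
Lemma univ_addN : left_inverse univ_zero univ_opp univ_add.
Proof.
move=> x; apply: univ_eqP => A f Pf.
by rewrite univ_evalD // univ_evalN // univ_eval0 // addNr.
Qed.

HB.instance Definition _ :=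
  GRing.isZmodule.Build univ_alg univ_addA univ_addC univ_add0 univ_addN.

Lemma univ_mulA : associative univ_mul.
Proof. by move=> x y z; apply: univ_eqP => A f Pf; rewrite !univ_evalM // rng_mulA. Qed.
Lemma univ_mulDl : left_distributive univ_mul univ_add.
Proof.
move=> x y z; apply: univ_eqP => A f Pf.
by rewrite univ_evalD // !univ_evalM // univ_evalD // rng_mulDl.
Qed.
Lemma univ_mulDr : right_distributive univ_mul univ_add.
Proof.
move=> x y z; apply: univ_eqP => A f Pf.
by rewrite univ_evalD // !univ_evalM // univ_evalD // rng_mulDr.
Qed.

HB.instance Definition _ :=
  Zmodule_isRng.Build univ_alg univ_mulA univ_mulDl univ_mulDr.

Lemma univ_scaleA a b x : univ_scale a (univ_scale b x) = univ_scale (a * b) x.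
Proof. by apply: univ_eqP => A f Pf; rewrite !univ_evalZ // scalerA. Qed.
Lemma univ_scale1 : left_id 1 univ_scale.
Proof. by move=> x; apply: univ_eqP => A f Pf; rewrite univ_evalZ // scale1r. Qed.
Lemma univ_scaleDr : right_distributive univ_scale univ_add.
Proof.
move=> a x y; apply: univ_eqP => A f Pf.
by rewrite univ_evalD // !univ_evalZ // univ_evalD // scalerDr.
Qed.
Lemma univ_scaleDl x a b :
  univ_scale (a + b) x = univ_add (univ_scale a x) (univ_scale b x).
Proof.
by apply: univ_eqP => A f Pf; rewrite univ_evalD // !univ_evalZ // scalerDl.
Qed.

HB.instance Definition _ := GRing.Zmodule_isLmodule.Build R univ_alg
  univ_scaleA univ_scale1 univ_scaleDr univ_scaleDl.

Lemma univ_scaleAl a x y : univ_scale a (univ_mul x y) = univ_mul (univ_scale a x) y.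
Proof.
apply: univ_eqP => A f Pf.
by rewrite univ_evalZ // !univ_evalM // univ_evalZ // rng_scaleAl.
Qed.
Lemma univ_scaleAr a x y : univ_scale a (univ_mul x y) = univ_mul x (univ_scale a y).
Proof.
apply: univ_eqP => A f Pf.
by rewrite univ_evalZ // !univ_evalM // univ_evalZ // rng_scaleAr.
Qed.

HB.instance Definition _ :=
  Rng_isRngAlgebra.Build R univ_alg univ_scaleAl univ_scaleAr.

Lemma univ_eval_hom (A : rngAlgType R) (f : X -> A) :
  P f -> alg_hom (univ_eval f : univ_alg -> A).
Proof.
move=> Pf; split=> [a x y|x y]; last exact: univ_evalM.
by rewrite [LHS]univ_evalD //; congr (_ + _); exact: univ_evalZ.
Qed.

Lemma univ_eval_ops (A : rngAlgType R) (f : X -> A) : P f ->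
  [/\ univ_eval f (0 : univ_alg) = 0,
      forall x y : univ_alg, univ_eval f (x + y) = univ_eval f x + univ_eval f y,
      forall x y : univ_alg, univ_eval f (x - y) = univ_eval f x - univ_eval f y &
      forall x y : univ_alg, univ_eval f (x ** y) = univ_eval f x ** univ_eval f y].
Proof.
move=> Pf; split=> [|x y|x y|x y]; [exact: univ_eval0|exact: univ_evalD| |exact: univ_evalM].
by rewrite [LHS]univ_evalD //; congr (_ + _); exact: univ_evalN.
Qed.

Lemma univ_lift (A : rngAlgType R) (f : X -> A) :
  P f -> exists2 h : univ_alg -> A, alg_hom h & forall x, h (univ_gen x) = f x.
Proof.
move=> Pf; exists (univ_eval f); first exact: univ_eval_hom.
by move=> x; exact: univ_eval_gen.
Qed.

Lemma univ_piE :
  [/\ \pi_univ_alg TZero = univ_zero,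
      forall t u, \pi_univ_alg (TAdd t u) = univ_add (\pi_univ_alg t) (\pi_univ_alg u),
      forall t, \pi_univ_alg (TOpp t) = univ_opp (\pi_univ_alg t),
      forall a t, \pi_univ_alg (TScale a t) = univ_scale a (\pi_univ_alg t) &
      forall t u, \pi_univ_alg (TMul t u) = univ_mul (\pi_univ_alg t) (\pi_univ_alg u)].
Proof.
split=> [|t u|t|a t|t u]; apply: univ_eqP => A f Pf.
- by [].
- by rewrite univ_evalD // !univ_evalE.
- by rewrite univ_evalN // !univ_evalE.
- by rewrite univ_evalZ // !univ_evalE.
- by rewrite univ_evalM // !univ_evalE.
Qed.

Lemma univ_ind (K : univ_alg -> Prop) :
  (forall x, K (univ_gen x)) -> K 0 ->
  (forall x y, K x -> K y -> K (x + y)) ->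
  (forall a x, K x -> K (a *: x)) ->
  (forall x y, K x -> K y -> K (x ** y)) ->
  forall x, K x.
Proof.
move=> Kg K0 KD KZ KM x; rewrite -[x]reprK.
have [pi0 piD piN piZ piM] := univ_piE.
elim: (repr x) => [y||t IHt u IHu|t IHt|a t IHt|t IHt u IHu].
- exact: Kg.
- by rewrite pi0.
- by rewrite piD; exact: KD.
- by rewrite piN; have := KZ (-1) _ IHt; rewrite scaleN1r.
- by rewrite piZ; exact: KZ.
- by rewrite piM; exact: KM.
Qed.

End UniversalAlgebra.

Record graph := Graph {
  vertex : countType;
  edge : countType;
  rE : edge -> vertex;
  sE : edge -> vertex
}.

Record leavitt_family (R : comPzRingType) (E : graph) (A : rngAlgType R)
    (Q : vertex E -> A) (T Ts : edge E -> A) : Prop := LeavittFamily {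
  LP1 : forall v w, Q v ** Q w = if v == w then Q v else 0;
  LP2 : forall e, [/\ Q (sE e) ** T e = T e, T e ** Q (rE e) = T e,
    Q (rE e) ** Ts e = Ts e & Ts e ** Q (sE e) = Ts e];
  LP3 : forall e f, Ts e ** T f = if e == f then Q (rE e) else 0;
  LP4 : forall v, finite_set [set e | sE e = v] -> [set e | sE e = v] !=set0 ->
    Q v = \sum_(e \in [set e | sE e = v]) T e ** Ts e
}.

Inductive graph_gen (E : graph) :=
  | GVertex of vertex E
  | GEdge of edge E
  | GGhost of edge E.

Definition is_leavitt_family (R : comPzRingType) (E : graph) (A : rngAlgType R)
    (f : graph_gen E -> A) : Prop :=
  leavitt_family (f \o @GVertex E) (f \o @GEdge E) (f \o @GGhost E).

Definition leavitt_path_algebra (R : comPzRingType) (E : graph) : rngAlgType R :=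
  univ_alg (@is_leavitt_family R E).

Record ultragraph := Ultragraph {
  uvertex : countType;
  uedge : countType;
  ur : uedge -> set uvertex;
  us : uedge -> uvertex;
  ur_neq0 : forall e, ur e !=set0
}.

Section GeneralizedVertices.
Variable G : ultragraph.

(* [set0] is the empty union; it is automatic unless there are no vertices. *)
Definition lattice_closed (M : set (set (uvertex G))) : Prop :=
  [/\ M set0, setU_closed M, setI_closed M &
      forall A B, M A -> M B -> M (A `\` B)].

Definition basic_vertex_sets : set (set (uvertex G)) :=
  range (fun v : uvertex G => [set v]) `|` range (@ur G).

Record gvertex := GVtx {
  gvset :> set (uvertex G);
  gvsetP : smallest lattice_closed basic_vertex_sets gvset
}.

Lemma lattice_closed_smallest :
  lattice_closed (smallest lattice_closed basic_vertex_sets).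
Proof.
split=> [M [[M0 _ _ _] _] //|A B GA GB M [Mc sM]|A B GA GB M [Mc sM]|A B GA GB M [Mc sM]];
  have MA := GA M (conj Mc sM); have MB := GB M (conj Mc sM);
  case: Mc => _ MU MI MD; by [apply: MU|apply: MI|apply: MD].
Qed.

Lemma gvertex_inj : injective gvset.
Proof.
move=> [A GA] [B GB] /= AB; case: _ / AB in GB *.
by congr GVtx; exact: Prop_irrelevance.
Qed.

Definition gv0 : gvertex.
Proof. by exists set0; have [] := lattice_closed_smallest. Defined.

Definition gvU (A B : gvertex) : gvertex.
Proof.
exists (A `|` B); have [_ + _ _] := lattice_closed_smallest.
by apply; exact: gvsetP.
Defined.

Definition gvI (A B : gvertex) : gvertex.
Proof.
exists (A `&` B); have [_ _ + _] := lattice_closed_smallest.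
by apply; exact: gvsetP.
Defined.

Definition gvD (A B : gvertex) : gvertex.
Proof.
exists (A `\` B); have [_ _ _ +] := lattice_closed_smallest.
by apply; exact: gvsetP.
Defined.

Definition gv1 (v : uvertex G) : gvertex.
Proof. by exists [set v]; apply: sub_gen_smallest; left; exists v. Defined.

Definition gvr (e : uedge G) : gvertex.
Proof. by exists (ur e); apply: sub_gen_smallest; right; exists e. Defined.

End GeneralizedVertices.

Arguments gv0 {G}.

Record ultra_leavitt_family (R : comPzRingType) (G : ultragraph)
    (A : rngAlgType R) (P : gvertex G -> A) (S Ss : uedge G -> A) : Prop :=
  UltraLeavittFamily {
  uLP1 : [/\ P gv0 = 0,
    forall B C, P (gvI B C) = P B ** P C &
    forall B C, P (gvU B C) = P B + P C - P (gvI B C)];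
  uLP2 : forall e, [/\ P (gv1 (us e)) ** S e = S e, S e ** P (gvr e) = S e,
    P (gvr e) ** Ss e = Ss e & Ss e ** P (gv1 (us e)) = Ss e];
  uLP3 : forall e f, Ss e ** S f = if e == f then P (gvr e) else 0;
  uLP4 : forall v, finite_set [set e | us e = v] -> [set e | us e = v] !=set0 ->
    P (gv1 v) = \sum_(e \in [set e | us e = v]) S e ** Ss e
}.

Inductive ultragraph_gen (G : ultragraph) :=
  | UVertex of gvertex G
  | UEdge of uedge G
  | UGhost of uedge G.

Definition is_ultra_leavitt_family (R : comPzRingType) (G : ultragraph)
    (A : rngAlgType R) (f : ultragraph_gen G -> A) : Prop :=
  ultra_leavitt_family (f \o @UVertex G) (f \o @UEdge G) (f \o @UGhost G).

Definition ultra_leavitt_path_algebra (R : comPzRingType) (G : ultragraph) :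
    rngAlgType R :=
  univ_alg (@is_ultra_leavitt_family R G).

Lemma univ_fsum (R : comPzRingType) (X : Type)
    (P : forall A : rngAlgType R, (X -> A) -> Prop)
    (A : rngAlgType R) (f : X -> A) (I : choiceType) (D : set I)
    (F : I -> univ_alg P) :
  P A f -> finite_set D ->
  univ_eval f (\sum_(i \in D) F i) = \sum_(i \in D) univ_eval f (F i).
Proof.
move=> Pf finD; rewrite !fsbig_finite //=.
have [e0 eD _ _] := univ_eval_ops Pf.
exact: (big_morph _ eD e0).
Qed.

Lemma leavitt_path_algebra_family (R : comPzRingType) (E : graph) :
  is_leavitt_family (univ_gen (@is_leavitt_family R E)).
Proof.
split=> /= [v w|e|e f|v finv v0].
- apply: univ_eqP => A h Ph; have [e0 _ _ eM] := univ_eval_ops Ph.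
  case: (Ph) => + _ _ _ => /(_ v w) /=.
  by case: ifP => _; rewrite eM ?e0 !univ_eval_gen.
- by split; apply: univ_eqP => A h Ph; have [_ _ _ eM] := univ_eval_ops Ph;
    case: (Ph) => _ + _ _ => /(_ e) /= []; rewrite eM !univ_eval_gen.
- apply: univ_eqP => A h Ph; have [e0 _ _ eM] := univ_eval_ops Ph.
  case: (Ph) => _ _ + _ => /(_ e f) /=.
  by case: ifP => _; rewrite eM ?e0 !univ_eval_gen.
- apply: univ_eqP => A h Ph; have [_ _ _ eM] := univ_eval_ops Ph.
  case: (Ph) => _ _ _ /(_ v finv v0) /= hv.
  rewrite univ_fsum // univ_eval_gen // hv.
  by apply: eq_fsbigr => e _; rewrite eM !univ_eval_gen.
Qed.

Lemma ultra_leavitt_path_algebra_family (R : comPzRingType) (G : ultragraph) :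
  is_ultra_leavitt_family (univ_gen (@is_ultra_leavitt_family R G)).
Proof.
split=> /= [|e|e f|v finv v0].
- by split=> [|B C|B C]; apply: univ_eqP => A h Ph;
    have [e0 eD eB eM] := univ_eval_ops Ph; case: (Ph) => -[/= P0 PI PU] _ _ _;
    rewrite ?eB ?eD ?eM ?e0 !univ_eval_gen.
- by split; apply: univ_eqP => A h Ph; have [_ _ _ eM] := univ_eval_ops Ph;
    case: (Ph) => _ + _ _ => /(_ e) /= []; rewrite eM !univ_eval_gen.
- apply: univ_eqP => A h Ph; have [e0 _ _ eM] := univ_eval_ops Ph.
  case: (Ph) => _ _ + _ => /(_ e f) /=.
  by case: ifP => _; rewrite eM ?e0 !univ_eval_gen.
- apply: univ_eqP => A h Ph; have [_ _ _ eM] := univ_eval_ops Ph.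
  case: (Ph) => _ _ _ /(_ v finv v0) /= hv.
  rewrite univ_fsum // univ_eval_gen // hv.
  by apply: eq_fsbigr => e _; rewrite eM !univ_eval_gen.
Qed.

(* Main.v *)
(** Enumerate the sets {v} and r(e) as C_0, C_1, ... and record a vertex x by the bits
  [x in C_0], [x in C_1], ...  The finite words realised by some vertex and containing a
  true bit form a forest; the node w stands for the set A_w of vertices with initial bits
  w, and A_w is the disjoint union of the sets of its children.  The graph E has these
  nodes as vertices, edges along the forest, and for each e an edge from the node of s(e)
  to each node of the finite partition of r(e) into sets A_w.

  For a module M over L(G), the sum of the p_(A_w) M over all nodes w is an L(E)-module.
  In the other direction L(E) contains a Leavitt G-family: p_A is the sum of the
  projections J_w J_w^* over the nodes w partitioning A, where J_w is the path from the
  top of the forest down to w; an L(E)-module is restricted along L(G) -> L(E) and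
  replaced by its unital part.  These functors are mutually inverse up to the isomorphisms
  m |-> (p_(A_w) m) for w topmost, and n |-> (J_w n) for all w.  Everything is checked on
  generators, so no uniqueness theorem is needed. *)
From HB Require Import structures.
Require Import Defs.
From mathcomp Require Import all_boot all_algebra.
From mathcomp Require Import boolp classical_sets functions cardinality fsbigop.

Set Implicit Arguments.
Unset Strict Implicit.
Unset Printing Implicit Defensive.

Import GRing.Theory.

Local Open Scope classical_set_scope.
Local Open Scope ring_scope.

(** * Non-unital rings and their modules *)

(** Objects of [MOD] are modules over a bare ring, whereas the universal property only produces maps
    into R-algebras. So every object first receives scalars from [R], and a module over a universal
    algebra is then built from a family in an algebra of linear endomorphisms. Both constructions of
    modules start on a space that is too large and pass to its unital part; left local units make
    this part nondegenerate and let finitely many projections fix any given element. The forest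
    answers a finiteness constraint: a range may be an infinite set of vertices, yet a vertex
    emitting finitely many edges must stay a finite emitter for the last Leavitt relation to carry
    over. The words of one fixed length cut a range into finitely many pieces, so one edge becomes
    finitely many links. Conjugation by the paths [J_w] turns projections at different nodes, always
    orthogonal in L(E), into the nested projections that an ultragraph demands. *)

Section RngTheory.
Variable S : rngType.
Implicit Types x y z : S.

Lemma rmul0 x : 0 ** x = 0.
Proof. by apply: (addrI (0 ** x)); rewrite -rng_mulDl !addr0. Qed.

Lemma rmulr0 x : x ** 0 = 0.
Proof. by apply: (addrI (x ** 0)); rewrite -rng_mulDr !addr0. Qed.

Lemma rmul_suml (I : Type) (r : seq I) (P : pred I) (F : I -> S) x :
  (\sum_(i <- r | P i) F i) ** x = \sum_(i <- r | P i) F i ** x.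
Proof.
by apply: (big_morph (fun y => y ** x)); [move=> a b; exact: rng_mulDl|exact: rmul0].
Qed.

Lemma rmul_sumr (I : Type) (r : seq I) (P : pred I) (F : I -> S) x :
  x ** (\sum_(i <- r | P i) F i) = \sum_(i <- r | P i) x ** F i.
Proof.
by apply: (big_morph (fun y => x ** y)); [move=> a b; exact: rng_mulDr|exact: rmulr0].
Qed.

Variable M : rngModType S.

Lemma act0l (m : M) : (0 : S) *> m = 0.
Proof. by apply: (addrI ((0 : S) *> m)); rewrite -rng_actDl !addr0. Qed.

Lemma act0r x : x *> (0 : M) = 0.
Proof. by apply: (addrI (x *> (0 : M))); rewrite -rng_actDr !addr0. Qed.

Lemma act_suml (I : Type) (r : seq I) (P : pred I) (F : I -> S) (m : M) :
  (\sum_(i <- r | P i) F i) *> m = \sum_(i <- r | P i) F i *> m.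
Proof.
by apply: (big_morph (fun y : S => y *> m)); [move=> a b; exact: rng_actDl|exact: act0l].
Qed.

Lemma act_sumr (I : Type) (r : seq I) (P : pred I) (F : I -> M) x :
  x *> (\sum_(i <- r | P i) F i) = \sum_(i <- r | P i) x *> F i.
Proof.
by apply: (big_morph (fun y : M => x *> y)); [move=> a b; exact: rng_actDr|exact: act0r].
Qed.

Lemma module_hom0 (N : rngModType S) (f : module_hom M N) : f 0 = 0.
Proof. by apply: (addrI (f 0)); rewrite -module_homD !addr0. Qed.

End RngTheory.

Definition left_local_units (S : rngType) : Prop :=
  forall s : seq S, exists u : S, forall x, x \in s -> u ** x = x.

(** * Scalars on modules over an R-algebra *)

HB.mixin Record RngModule_isLinear (R : pzRingType) (S : rngAlgType R) M
    of RngModule S M & GRing.Lmodule R M := {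
  act_scalel : forall (c : R) (a : S) (m : M), (c *: a) *> m = c *: (a *> m);
  act_scaler : forall (c : R) (a : S) (m : M), a *> (c *: m) = c *: (a *> m)
}.

#[short(type="linModType")]
HB.structure Definition LinModule (R : pzRingType) (S : rngAlgType R) :=
  {M of RngModule_isLinear R S M & RngModule S M & GRing.Lmodule R M}.

Section DerivedScalars.
Variables (R : comPzRingType) (S : rngAlgType R) (M : MOD_obj S).

Lemma nondeg_eq (m n : M) : (forall a : S, a *> m = a *> n) -> m = n.
Proof.
move=> mn; apply/eqP; rewrite -subr_eq0; apply/eqP.
apply: (MOD_nondegenerate (m := M)) => a; apply: (addIr (a *> n)).
by rewrite -rng_actDr subrK add0r.
Qed.

(* The scalar c acts on m = \sum a_i m_i by \sum (c a_i) m_i; nondegeneracy makes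
  this independent of the decomposition. *)
Lemma derived_scale_ex (c : R) (m : M) :
  exists n : M, forall b : S, b *> n = (c *: b) *> m.
Proof.
have [s ->] := MOD_unital m; exists (\sum_(p <- s) (c *: p.1) *> p.2) => b.
rewrite !act_sumr; apply: eq_bigr => p _.
by rewrite -!rng_actA -rng_scaleAl -rng_scaleAr.
Qed.

Definition derived_scale c m := projT1 (cid (derived_scale_ex c m)).

Lemma derived_scaleP c m (b : S) : b *> derived_scale c m = (c *: b) *> m.
Proof. by rewrite /derived_scale; case: cid. Qed.

Definition linearized : Type := M.
HB.instance Definition _ := RngModule.on linearized.

Fact derived_scaleA a b m :
  derived_scale a (derived_scale b m) = derived_scale (a * b) m.
Proof. by apply: nondeg_eq => d; rewrite !derived_scaleP scalerA mulrC. Qed.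

Fact derived_scale1 : left_id 1 derived_scale.
Proof. by move=> m; apply: nondeg_eq => d; rewrite derived_scaleP scale1r. Qed.

Fact derived_scaleDr : right_distributive derived_scale +%R.
Proof.
by move=> a m n; apply: nondeg_eq => d; rewrite rng_actDr !derived_scaleP rng_actDr.
Qed.

Fact derived_scaleDl m a b :
  derived_scale (a + b) m = derived_scale a m + derived_scale b m.
Proof.
by apply: nondeg_eq => d; rewrite rng_actDr !derived_scaleP -rng_actDl scalerDl.
Qed.

HB.instance Definition _ := GRing.Zmodule_isLmodule.Build R linearized
  derived_scaleA derived_scale1 derived_scaleDr derived_scaleDl.

Fact derived_act_scaler (c : R) (a : S) (m : linearized) : a *> (c *: m) = c *: (a *> m).
Proof.
apply: nondeg_eq => b; rewrite -rng_actA; apply: etrans (derived_scaleP _ _ _) _.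
by rewrite (derived_scaleP c (a *> m) b) -rng_actA rng_scaleAl.
Qed.

Fact derived_act_scalel (c : R) (a : S) (m : linearized) : (c *: a) *> m = c *: (a *> m).
Proof. by rewrite -derived_act_scaler; exact/esym/derived_scaleP. Qed.

HB.instance Definition _ := RngModule_isLinear.Build R S linearized
  derived_act_scalel derived_act_scaler.

(** Nondegeneracy determines the scalar multiple from its products with [S]. This identifies the
    derived scalars with scalars that a module already carries. *)
Lemma linearized_scaleP (c : R) (m n : linearized) :
  (forall b : S, b *> n = (c *: b) *> m) -> c *: m = n.
Proof.
by move=> e; apply: nondeg_eq => b; apply: etrans (derived_scaleP _ _ _) _; exact/esym/e.
Qed.

End DerivedScalars.
Arguments linearized {R S} M.

(** The derived scalars are characterised by the ring action alone, so a homomorphism of ring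
    modules respects them automatically. *)
Lemma module_hom_linear (R : comPzRingType) (S : rngAlgType R) (M N : MOD_obj S)
  (f : module_hom M N) : linear (f : linearized M -> linearized N).
Proof.
move=> c m n; rewrite module_homD; congr (_ + _).
apply/esym/linearized_scaleP => b.
apply: etrans (module_homZ f (c *: b) m); apply: etrans (esym (module_homZ f b _)) _.
by congr (f _); exact: derived_scaleP.
Qed.

(** * Endomorphism algebras *)

Section Endo.
Variables (R : comPzRingType) (V : lmodType R).

Definition endo_pred : {pred V -> V} := fun f => `[< linear f >].

Fact endo_closed : submod_closed endo_pred.
Proof.
split; first by apply/asboolP => a u v; rewrite [RHS]addr0 [RHS]scaler0.
move=> a f g /asboolP lf /asboolP lg; apply/asboolP => b u v.
rewrite /= !fctE lf lg !scalerDr !scalerA [b * a]mulrC.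
by rewrite -!addrA; congr (_ + _); rewrite addrCA.
Qed.

HB.instance Definition _ := GRing.isSubmodClosed.Build R (V -> V) endo_pred
  (GRing.submod_closed_semi endo_closed).

Record endo := Endo { endo_fun :> V -> V; endo_funP : endo_fun \in endo_pred }.
HB.instance Definition _ := [isSub for endo_fun].
HB.instance Definition _ := [Choice of endo by <:].
HB.instance Definition _ := [SubChoice_isSubLmodule of endo by <:].

Lemma endo_linear (f : endo) : linear f.
Proof. by case: f => f /= /asboolP. Qed.

Lemma endoD (f : endo) u v : f (u + v) = f u + f v.
Proof. by have := endo_linear f 1 u v; rewrite !scale1r. Qed.

Lemma endoZ (f : endo) a u : f (a *: u) = a *: f u.
Proof.
have f0 : f 0 = 0 by apply: (addrI (f 0)); rewrite -endoD !addr0.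
by have := endo_linear f a u 0; rewrite !addr0 f0 addr0.
Qed.

Lemma endo_ext (f g : endo) : (forall v, f v = g v) -> f = g.
Proof. by move=> fg; apply: val_inj; apply: funext. Qed.

Lemma endo_addE (f g : endo) v : (f + g) v = f v + g v. Proof. by []. Qed.

Definition mk_endo (f : V -> V) (lf : linear f) : endo := Endo (asboolT lf).

Fact endo_comp_linear (f g : endo) : linear (fun v => f (g v)).
Proof. by move=> a u v; rewrite !endo_linear. Qed.

Definition endo_comp (f g : endo) := mk_endo (endo_comp_linear f g).

Fact endo_compA : associative endo_comp.
Proof. by move=> f g h; apply: endo_ext. Qed.
Fact endo_compDl : left_distributive endo_comp +%R.
Proof. by move=> f g h; apply: endo_ext. Qed.
Fact endo_compDr : right_distributive endo_comp +%R.
Proof. by move=> f g h; apply: endo_ext => v; rewrite /= endoD. Qed.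
HB.instance Definition _ :=
  Zmodule_isRng.Build endo endo_compA endo_compDl endo_compDr.

Fact endo_scaleAl a (f g : endo) : a *: (f ** g) = (a *: f) ** g.
Proof. by apply: endo_ext. Qed.
Fact endo_scaleAr a (f g : endo) : a *: (f ** g) = f ** (a *: g).
Proof. by apply: endo_ext => v; rewrite /= endoZ. Qed.
HB.instance Definition _ := Rng_isRngAlgebra.Build R endo endo_scaleAl endo_scaleAr.

Lemma endo_mulE (f g : endo) v : (f ** g) v = f (g v). Proof. by []. Qed.

End Endo.

(** * Modules from families of endomorphisms *)

Section Representation.
Variables (R : comPzRingType) (X : Type).
Variable P : forall A : rngAlgType R, (X -> A) -> Prop.
Local Notation L := (univ_alg P).
Variables (V : lmodType R) (rho : X -> endo V) (Prho : P rho).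

(** The proof is an argument of the type so that the module instances can recover the family [rho]
    from it. *)
Definition rep_module (_ : P rho) : Type := V.
Local Notation rep := (rep_module Prho).
HB.instance Definition _ := GRing.Lmodule.on rep.

Definition rep_act (a : L) (v : rep) : rep := univ_eval rho a (v : V).

Fact rep_actA a b v : rep_act (a ** b) v = rep_act a (rep_act b v).
Proof. by have [_ _ _ eM] := univ_eval_ops Prho; rewrite /rep_act eM. Qed.
Fact rep_actDl a b v : rep_act (a + b) v = rep_act a v + rep_act b v.
Proof. by have [_ eD _ _] := univ_eval_ops Prho; rewrite /rep_act eD. Qed.
Fact rep_actDr a u v : rep_act a (u + v) = rep_act a u + rep_act a v.
Proof. exact: (@endoD _ V (univ_eval rho a)). Qed.
HB.instance Definition _ :=
  Zmodule_isRngModule.Build L rep rep_actA rep_actDl rep_actDr.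

Fact rep_act_scalel c (a : L) (v : rep) : (c *: a) *> v = c *: (a *> v).
Proof.
have /(_ c a v) : forall c a v, rep_act (c *: a) v = c *: rep_act a v by
  move=> d b w; rewrite /rep_act [univ_eval _ _](univ_evalZ Prho).
by [].
Qed.
Fact rep_act_scaler c (a : L) (v : rep) : a *> (c *: v) = c *: (a *> v).
Proof. exact: (@endoZ _ V (univ_eval rho a)). Qed.
HB.instance Definition _ :=
  RngModule_isLinear.Build R L rep rep_act_scalel rep_act_scaler.

Lemma rep_act_gen x (v : rep) : univ_gen P x *> v = rho x v.
Proof.
by have -> : univ_gen P x *> v = univ_eval rho (univ_gen P x) v by []; rewrite univ_eval_gen.
Qed.

End Representation.

(** The elements commuting with [f] are closed under all algebra operations, so [univ_ind] reduces
    the claim to generators. *)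
Lemma intertwiner (R : comPzRingType) (X : Type)
    (P : forall A : rngAlgType R, (X -> A) -> Prop)
    (V W : linModType (univ_alg P)) (f : V -> W) : linear f ->
  (forall x v, f (univ_gen P x *> v) = univ_gen P x *> f v) ->
  forall a v, f (a *> v) = a *> f v.
Proof.
move=> lf fgen.
have fD u v : f (u + v) = f u + f v by have := lf 1 u v; rewrite !scale1r.
have f0 : f 0 = 0 by apply: (addrI (f 0)); rewrite -fD !addr0.
have fZ a u : f (a *: u) = a *: f u by have := lf a u 0; rewrite f0 !addr0.
apply: univ_ind => [x v|v|a b IHa IHb v|c a IHa v|a b IHa IHb v].
- exact: fgen.
- by rewrite !act0l.
- by rewrite !rng_actDl fD IHa IHb.
- by rewrite !act_scalel fZ IHa.
- by rewrite !rng_actA IHa IHb.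
Qed.

(** * The unital part of a module *)

Section UnitalPart.
Variables (R : comPzRingType) (S : rngAlgType R) (V : linModType S).
Hypothesis luS : left_local_units S.

Definition upart_pred : {pred V} :=
  fun v => `[< exists s : seq (S * V), v = \sum_(p <- s) p.1 *> p.2 >].

Fact upart_closed : submod_closed upart_pred.
Proof.
split; first by apply/asboolP; exists [::]; rewrite big_nil.
move=> a u v /asboolP [s ->] /asboolP [t ->]; apply/asboolP.
exists ([seq (a *: p.1, p.2) | p <- s] ++ t).
rewrite big_cat /= big_map scaler_sumr; congr (_ + _).
by apply: eq_bigr => p _; rewrite act_scalel.
Qed.

HB.instance Definition _ := GRing.isSubmodClosed.Build R V upart_pred
  (GRing.submod_closed_semi upart_closed).

Record upart (lu : left_local_units S) :=
  Upart { upart_val :> V; upart_valP : upart_val \in upart_pred }.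
Local Notation U := (upart luS).
HB.instance Definition _ := [isSub for @upart_val luS].
HB.instance Definition _ := [Choice of U by <:].
HB.instance Definition _ := [SubChoice_isSubLmodule of U by <:].

Lemma act_upart (a : S) (v : V) : a *> v \in upart_pred.
Proof. by apply/asboolP; exists [:: (a, v)]; rewrite big_seq1. Qed.

Definition mk_upart (v : V) (vP : v \in upart_pred) : U := @Upart luS v vP.
Definition upart_act (a : S) (u : U) : U := mk_upart (act_upart a u).

Fact upart_actA a b u : upart_act (a ** b) u = upart_act a (upart_act b u).
Proof. by apply: val_inj; rewrite /= rng_actA. Qed.
Fact upart_actDl a b u : upart_act (a + b) u = upart_act a u + upart_act b u.
Proof. by apply: val_inj; rewrite /= rng_actDl. Qed.
Fact upart_actDr a u v : upart_act a (u + v) = upart_act a u + upart_act a v.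
Proof. by apply: val_inj; rewrite /= rng_actDr. Qed.
HB.instance Definition _ :=
  Zmodule_isRngModule.Build S U upart_actA upart_actDl upart_actDr.

Fact upart_act_scalel c (a : S) (v : U) : (c *: a) *> v = c *: (a *> v).
Proof. by apply: val_inj; exact: act_scalel. Qed.
Fact upart_act_scaler c (a : S) (v : U) : a *> (c *: v) = c *: (a *> v).
Proof. by apply: val_inj; exact: act_scaler. Qed.
HB.instance Definition _ :=
  RngModule_isLinear.Build R S U upart_act_scalel upart_act_scaler.

Lemma upart_actE (a : S) (u : U) : upart_val (a *> u) = a *> upart_val u.
Proof. by []. Qed.

(** A local unit for the finitely many coefficients in a decomposition of [u] fixes [u]. Both
    unitality and nondegeneracy follow from it. *)
Lemma upart_unit (u : U) : exists e : S, e *> upart_val u = upart_val u.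
Proof.
have /asboolP [s us] := upart_valP u; have [e eP] := luS [seq p.1 | p <- s].
exists e; rewrite us act_sumr; apply: eq_big_seq => p ps.
by rewrite -rng_actA eP // map_f.
Qed.

Fact upart_unital : unital_module U.
Proof.
move=> u; have [e eu] := upart_unit u; exists [:: (e, u)].
by rewrite big_seq1; apply: val_inj; rewrite /= eu.
Qed.

Fact upart_nondegenerate : nondegenerate_module U.
Proof.
by move=> u Su; have [e eu] := upart_unit u; apply: val_inj; rewrite /= -eu -upart_actE Su.
Qed.

Definition upartMOD : MOD_obj S := MODObj upart_unital upart_nondegenerate.

(** Passing to an object of [MOD] forgets the scalars and [linearized] rebuilds them from the ring
    action; the result agrees with the scalars inherited from [V]. *)
Lemma linearized_upart_scaleE c (u : U) :
  c *: (u : linearized upartMOD) = (c *: u : U).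
Proof.
apply: linearized_scaleP => b.
by have -> : b *> (c *: u : U) = (c *: b) *> u by rewrite act_scaler act_scalel.
Qed.

End UnitalPart.

Section UnitalPartMap.
Variables (R : comPzRingType) (S : rngAlgType R) (V W : linModType S).
Variables (luS : left_local_units S) (f : V -> W).
Hypotheses (fD : {morph f : x y / x + y}) (fZ : forall (a : S) x, f (a *> x) = a *> f x).

Fact upart_map_subproof (u : upart V luS) : f u \in @upart_pred R S W.
Proof.
by have [e <-] := upart_unit u; rewrite fZ; exact: act_upart.
Qed.

Definition upart_map (u : upart V luS) := mk_upart luS (upart_map_subproof u).

Fact upart_mapD : {morph upart_map : x y / x + y}.
Proof. by move=> x y; apply: val_inj; exact: fD. Qed.
Fact upart_mapZ (a : S) x : upart_map (a *> x) = a *> upart_map x.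
Proof. by apply: val_inj; exact: fZ. Qed.

Definition upart_hom : module_hom (upartMOD V luS) (upartMOD W luS) :=
  ModuleHom upart_mapD upart_mapZ.
End UnitalPartMap.

(** * Restriction along an algebra homomorphism *)

Section Pullback.
Variables (R : comPzRingType) (S T : rngAlgType R) (phi : S -> T) (hphi : alg_hom phi).
Variable V : linModType T.

Definition pullback (_ : alg_hom phi) : Type := V.
Local Notation pull := (pullback hphi).
HB.instance Definition _ := GRing.Lmodule.on pull.
Definition pull_act (a : S) (v : pull) : pull := phi a *> (v : V).

Fact alg_homD a b : phi (a + b) = phi a + phi b.
Proof. by case: (hphi) => lphi _; have := lphi 1 a b; rewrite !scale1r. Qed.
Fact alg_hom0 : phi 0 = 0.
Proof. by apply: (addrI (phi 0)); rewrite -alg_homD !addr0. Qed.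
Fact alg_homZ c a : phi (c *: a) = c *: phi a.
Proof. by case: (hphi) => lphi _; have := lphi c a 0; rewrite alg_hom0 !addr0. Qed.

Fact pull_actA a b v : pull_act (a ** b) v = pull_act a (pull_act b v).
Proof. by rewrite /pull_act hphi.2 rng_actA. Qed.
Fact pull_actDl a b v : pull_act (a + b) v = pull_act a v + pull_act b v.
Proof. by rewrite /pull_act alg_homD rng_actDl. Qed.
Fact pull_actDr a u v : pull_act a (u + v) = pull_act a u + pull_act a v.
Proof. exact: rng_actDr. Qed.
HB.instance Definition _ :=
  Zmodule_isRngModule.Build S pull pull_actA pull_actDl pull_actDr.

Lemma pull_actE (a : S) (v : pull) : a *> v = phi a *> (v : V).
Proof. by []. Qed.

Fact pull_act_scalel c (a : S) (v : pull) : (c *: a) *> v = c *: (a *> v).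
Proof. by rewrite !pull_actE alg_homZ; exact: act_scalel. Qed.
Fact pull_act_scaler c (a : S) (v : pull) : a *> (c *: v) = c *: (a *> v).
Proof. exact: act_scaler. Qed.
HB.instance Definition _ :=
  RngModule_isLinear.Build R S pull pull_act_scalel pull_act_scaler.
End Pullback.

(** * Natural isomorphisms from bijective homomorphisms *)

Section BijectiveHom.
Variables (S : rngType) (M N : rngModType S) (f : module_hom M N).
Hypotheses (finj : injective f) (fsurj : forall n, exists m, f m = n).

Definition hom_inv_fun n := projT1 (cid (fsurj n)).
Lemma hom_invK n : f (hom_inv_fun n) = n.
Proof. by rewrite /hom_inv_fun; case: cid. Qed.
Fact hom_invD : {morph hom_inv_fun : x y / x + y}.
Proof. by move=> x y; apply: finj; rewrite module_homD !hom_invK. Qed.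
Fact hom_invZ (a : S) x : hom_inv_fun (a *> x) = a *> hom_inv_fun x.
Proof. by apply: finj; rewrite module_homZ !hom_invK. Qed.
Definition hom_inv : module_hom N M := ModuleHom hom_invD hom_invZ.
End BijectiveHom.

(** The natural maps to be built go from the identity to [F], while an equivalence asks for the
    direction out of [F]; hence the inverses serve as [nat_to]. *)
Lemma nat_iso_of_bijective (S : rngType) (F : functor (MOD S) (MOD S))
    (h : forall M : MOD S, module_hom M (F M)) :
  (forall M, injective (h M)) -> (forall M n, exists m, h M m = n) ->
  (forall (M N : MOD S) (f : mor M N) x, h N (module_fun f x) = module_fun (fmap F f) (h M x)) ->
  inhabited (nat_iso F (functor_id (MOD S))).
Proof.
move=> hinj hsurj hnat; split.
apply: (@NatIso _ _ F (functor_id _)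
  (fun M => hom_inv (@hinj M) (hsurj M)) (fun M => h M)) => [M|M|M N f].
- by apply: module_hom_ext => x /=; exact: hom_invK.
- by apply: module_hom_ext => x /=; apply: (hinj M); exact: hom_invK.
- apply: module_hom_ext => x /=; apply: (hinj N).
  by rewrite hom_invK hnat hom_invK.
Qed.

(** * The tree of an ultragraph *)

Fixpoint bitseqs (n : nat) : seq (seq bool) :=
  if n is n'.+1 then map (cons false) (bitseqs n') ++ map (cons true) (bitseqs n')
  else [:: [::]].

Lemma mem_bitseqs n w : (w \in bitseqs n) = (size w == n).
Proof.
elim: n w => [|n IHn] [|b w] //=; rewrite mem_cat.
  by apply/negbTE/negP => /orP [] /mapP [].
rewrite eqSS -IHn; apply/orP/idP => [[] /mapP [w' w'n [_ ->]] //|wn].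
by case: b; [right|left]; apply: map_f.
Qed.

Lemma bitseqs_uniq n : uniq (bitseqs n).
Proof.
elim: n => //= n IHn; rewrite cat_uniq !map_inj_uniq ?IHn ?andbT //=; try by move=> ? ? [].
by apply/hasPn => _ /mapP [w _ ->]; apply/negP => /mapP [].
Qed.

Lemma big_bitseqsS (Z : nmodType) n (F : seq bool -> Z) :
  \sum_(w <- bitseqs n.+1) F w = \sum_(w <- bitseqs n) (F (false :: w) + F (true :: w)).
Proof. by rewrite big_split /= big_cat !big_map. Qed.

Arguments bitseqs n : simpl never.

Lemma big_bitseqs_only (Z : nmodType) n w (F : seq bool -> Z) : w \in bitseqs n ->
  (forall w', w' \in bitseqs n -> w' != w -> F w' = 0) -> \sum_(w' <- bitseqs n) F w' = F w.
Proof.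
move=> wn F0; rewrite (bigD1_seq w) ?bitseqs_uniq //= big1_seq ?addr0 // => w' /andP [ww' w'n].
exact: F0.
Qed.

Section Tree.
Variable G : ultragraph.
Local Notation V := (uvertex G).
Local Notation Ed := (uedge G).

(** A number that codes neither a vertex nor an edge yields the empty set, so its bit is false for
    every vertex. *)
Definition gen_set (n : nat) : set V :=
  match pickle_inv n : option (V + Ed) with
  | Some (inl v) => [set v]
  | Some (inr e) => ur e
  | None => set0
  end.

Definition vidx (v : V) : nat := pickle (inl v : V + Ed).
Definition eidx (e : Ed) : nat := pickle (inr e : V + Ed).
Definition vertex_index (n : nat) : bool :=
  if pickle_inv n : option (V + Ed) is Some (inl _) then true else false.

Lemma gen_set_vidx v : gen_set (vidx v) = [set v].
Proof. by rewrite /gen_set /vidx pickleK_inv. Qed.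
Lemma gen_set_eidx e : gen_set (eidx e) = ur e.
Proof. by rewrite /gen_set /eidx pickleK_inv. Qed.

Lemma vertex_indexP n v : (vertex_index n && `[< gen_set n v >]) = (n == vidx v).
Proof.
apply/andP/eqP => [[]|->]; last first.
  by split; [rewrite /vertex_index /vidx pickleK_inv|rewrite gen_set_vidx; apply/asboolP].
rewrite /vertex_index /gen_set; have := @pickle_invK (V + Ed)%type n.
by case: pickle_inv => //= -[u|//] <- _ /asboolP /= ->.
Qed.

(* The most recent bit comes first, so that consing a bit descends in the tree. *)
Fixpoint bits (v : V) (n : nat) : seq bool :=
  if n is n'.+1 then `[< gen_set n' v >] :: bits v n' else [::].

Lemma size_bits v n : size (bits v n) = n.
Proof. by elim: n => //= n ->. Qed.

Definition wset (w : seq bool) : set V := [set v | bits v (size w) = w].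

(* The all-false words are excluded: their sets are complements of finite unions
  of generators and need not be generalized vertices. *)
Definition valid (w : seq bool) : bool := has id w && `[< wset w !=set0 >].

Lemma validP w : reflect (has id w /\ exists v, bits v (size w) = w) (valid w).
Proof. by apply: (iffP andP) => [[hw /asboolP]|[hw /asboolP]]. Qed.

Lemma validN_wset w : has id w -> ~~ valid w -> wset w = set0.
Proof.
rewrite /valid => -> /asboolP w0; rewrite -subset0 => v wv.
by apply: w0; exists v.
Qed.

Lemma bits_behead v b w : bits v (size (b :: w)) = b :: w -> bits v (size w) = w.
Proof. by case. Qed.

Lemma valid_behead b w : valid (b :: w) -> has id w -> valid w.
Proof. by move=> /validP [_ [v [_ vw]]] hw; apply/validP; split=> //; exists v. Qed.

(** A true bit at the index of a vertex [u] confines [wset w] to [u]; a valid word with such a bit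
    is realised by one vertex only. *)
Fixpoint isolated (w : seq bool) : bool :=
  if w is b :: w' then isolated w' || (vertex_index (size w') && b) else false.

Lemma isolated_has w : isolated w -> has id w.
Proof. by elim: w => //= b w IHw /orP [/IHw ->|/andP [_ ->]] //; rewrite orbT. Qed.

Lemma isolated_behead w : isolated (behead w) -> isolated w.
Proof. by case: w => //= b w ->. Qed.

Lemma isolated_bits v n : isolated (bits v n) = (vidx v < n)%N.
Proof.
elim: n => //= n IHn; rewrite IHn size_bits vertex_indexP ltnS [RHS]leq_eqVlt.
by rewrite orbC eq_sym.
Qed.

Lemma isolated_inj w u v : isolated w -> bits u (size w) = w -> bits v (size w) = w -> u = v.
Proof.
elim: w => //= b w IHw /orP [cw [_ uw] [_ vw]|/andP [iw bt] [uw _] [vw _]].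
  exact: IHw.
have /eqP nu := vertex_indexP (size w) u; have /eqP nv := vertex_indexP (size w) v.
move: nu nv; rewrite uw vw iw bt /= => /eqP/esym/eqP -> /eqP/esym/eqP.
by move/(pcan_inj pickleK) => [].
Qed.

(** The shortest word of [v] that isolates it: the successor is there because bit number [vidx v]
    must itself be read. *)
Definition nv (v : V) : seq bool := bits v (vidx v).+1.

Lemma bits_has v n : isolated (bits v n) -> valid (bits v n).
Proof.
by move=> c; apply/validP; split; [exact: isolated_has|exists v; rewrite size_bits].
Qed.

Lemma isolated_nv v : isolated (nv v).
Proof. by rewrite isolated_bits. Qed.
Lemma valid_nv v : valid (nv v).
Proof. exact/bits_has/isolated_nv. Qed.
Lemma nv_behead_open v : ~~ isolated (behead (nv v)).
Proof. by rewrite isolated_bits ltnn. Qed.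

(** If the parent is still open, the newest bit is the isolating one, so its position is the index
    of the vertex realising [w]. *)
Lemma isolated_openP w : valid w -> isolated w -> ~~ isolated (behead w) -> exists v, w = nv v.
Proof.
case: w => // b w /validP [_ [v vw]] /= cw ncw; exists v.
have [_ vw'] := vw.
suff -> : nv v = bits v (size (b :: w)) by rewrite vw.
rewrite /nv /=; have := isolated_bits v (size (b :: w)).
rewrite vw /= cw => /esym; rewrite ltnS leq_eqVlt => /orP [/eqP <- //|].
by rewrite -isolated_bits vw' (negbTE ncw).
Qed.

Lemma wset_nv v : wset (nv v) = [set v].
Proof.
apply/seteqP; split=> [u uv|_ ->]; last by rewrite /wset /= size_bits.
by apply: (isolated_inj (isolated_nv v) uv); rewrite size_bits.
Qed.

Lemma nv_inj : injective nv.
Proof. by move=> u v uv; have := wset_nv u; rewrite uv wset_nv => /seteqP [] /(_ _ erefl). Qed.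

(** At length [(eidx e).+1] the newest bit records membership in [ur e], so these words are the
    finitely many pieces of the range. *)
Definition edge_word (e : Ed) (w : seq bool) : bool :=
  [&& valid w, size w == (eidx e).+1 & head false w].

Lemma edge_wordP e w : reflect (size w = (eidx e).+1 /\ exists2 v, ur e v & bits v (size w) = w)
  (edge_word e w).
Proof.
apply: (iffP and3P) => [[/validP [_ [v vw]] /eqP sw hw]|[sw [v ev vw]]].
  split=> //; exists v => //; move: hw; rewrite -vw sw /= gen_set_eidx.
  by move/asboolP.
have hw : head false w by rewrite -vw sw /= gen_set_eidx; apply/asboolP.
split=> //; last exact/eqP.
by apply/validP; split; [case: (w) hw => //= b w' ->|exists v].
Qed.

Lemma edge_word_ex e : exists w, edge_word e w.
Proof.
have [v ev] := ur_neq0 e; exists (bits v (eidx e).+1).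
by apply/edge_wordP; rewrite size_bits; split=> //; exists v; rewrite ?size_bits.
Qed.

(* [meas A n]: A is a union of sets wset w with w a word of length n containing true. *)
Definition meas (A : set V) (n : nat) : Prop :=
  forall u v, bits u n = bits v n -> A u -> has id (bits u n) /\ A v.

Lemma bits_has_leq v m n : (m <= n)%N -> has id (bits v m) -> has id (bits v n).
Proof. by move=> /subnK <- hm; elim: (n - m)%N => //= k ->; rewrite orbT. Qed.

(* The topmost node above [w]: the truncation of [w] at its oldest true bit. *)
Fixpoint apex (w : seq bool) : seq bool :=
  if w is b :: w' then if has id w' then apex w' else w else [::].
Definition is_apex (w : seq bool) : bool := has id w && ~~ has id (behead w).

Lemma apex_is_apex w : has id w -> is_apex (apex w).
Proof.
elim: w => //= b w IHw; case: ifP => [hw _|hw]; first exact: IHw.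
by rewrite orbF /is_apex /= hw orbF andbT.
Qed.

Lemma bits_apex v w : bits v (size w) = w -> bits v (size (apex w)) = apex w.
Proof. by elim: w => //= b w IHw vw; case: ifP => // _; apply: IHw; case: vw. Qed.

(** Both words are read off [v]; if one were shorter, its true bit would occur among the older bits
    of the other, which an apex forbids. *)
Lemma is_apex_unique v w w' : is_apex w -> is_apex w' ->
  bits v (size w) = w -> bits v (size w') = w' -> w = w'.
Proof.
have key x y : is_apex x -> is_apex y -> bits v (size x) = x -> bits v (size y) = y ->
    ~ (size x < size y)%N.
  case: y => // b y /andP [hx _] /andP [_ hy] vx /= [_ vy] xy.
  by move: hy; rewrite -vy (@bits_has_leq v (size x)) // vx.
move=> rw rw' vw vw'; rewrite -vw -vw'; congr (bits v _).
case: (ltngtP (size w) (size w')) => // lt; exfalso; first exact: key rw rw' vw vw' lt.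
exact: key rw' rw vw' vw lt.
Qed.

Lemma measS A n : meas A n -> meas A n.+1.
Proof. by move=> mA u v [_ uv] Au; have [/= hu Av] := mA u v uv Au; rewrite hu orbT. Qed.

Lemma meas_leq A m n : (m <= n)%N -> meas A m -> meas A n.
Proof. by move=> /subnK <- mA; elim: (n - m)%N => //= k; exact: measS. Qed.

(** Two sets can be brought to a common level, where the Boolean operations act word by word. *)
Lemma meas_lattice : lattice_closed [set A | exists n, meas A n].
Proof.
have max2 A B : (exists n, meas A n) -> (exists n, meas B n) -> exists n, meas A n /\ meas B n.
  move=> [m mA] [n nB]; exists (maxn m n).
  by split; [apply: meas_leq mA; exact: leq_maxl|apply: meas_leq nB; exact: leq_maxr].
split=> [|A B MA MB|A B MA MB|A B MA MB]; first by exists 0%N.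
- have [n [mA mB]] := max2 A B MA MB; exists n => u v uv [/(mA _ _ uv)|/(mB _ _ uv)] [hu ?].
    by split=> //; left.
  by split=> //; right.
- have [n [mA mB]] := max2 A B MA MB; exists n => u v uv [/(mA _ _ uv) [hu Av] /(mB _ _ uv)[_ Bv]].
  by split.
- have [n [mA mB]] := max2 A B MA MB; exists n => u v uv [/(mA _ _ uv) [hu Av] nBu].
  by split=> //; split=> // /(mB _ _ (esym uv)) [].
Qed.

Lemma meas_gen_set n : meas (gen_set n) n.+1.
Proof.
move=> u v /= [uv _] nu.
by rewrite -[gen_set n v]asboolE -uv (asboolT nu).
Qed.

Lemma ex_meas (A : gvertex G) : exists n, meas A n.
Proof.
suff MA : [set B | exists n, meas B n] (gvset A) by [].
apply: (gvsetP A); split; first exact: meas_lattice.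
move=> _ [[v _ <-]|[e _ <-]].
  by exists (vidx v).+1; rewrite -gen_set_vidx; exact: meas_gen_set.
by exists (eidx e).+1; rewrite -gen_set_eidx; exact: meas_gen_set.
Qed.

Definition glevel (A : gvertex G) : nat := projT1 (cid (ex_meas A)).
Lemma glevelP (A : gvertex G) : meas A (glevel A).
Proof. by rewrite /glevel; case: cid. Qed.

(** For [A] measurable at the length of [w], meeting [wset w] already means containing it. *)
Definition hits (A : set V) (w : seq bool) : bool :=
  `[< exists2 v, A v & bits v (size w) = w >].

Lemma meas_wset w : has id w -> meas (wset w) (size w).
Proof. by move=> hw u v uv; rewrite /wset /= => uw; rewrite uw; split; rewrite -?uv. Qed.

Lemma meas_ur e : meas (ur e) (eidx e).+1.
Proof. by rewrite -gen_set_eidx; exact: meas_gen_set. Qed.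

Fact word_gvertex_subproof w :
  smallest (@lattice_closed G) (@basic_vertex_sets G) (if has id w then wset w else set0).
Proof.
have [M0 MU MI MD] := lattice_closed_smallest G.
have Mgen n : smallest (@lattice_closed G) (@basic_vertex_sets G) (gen_set n).
  rewrite /gen_set; case: pickle_inv => [[v|e]|] //; [exact: (gvsetP (gv1 v))|exact: (gvsetP (gvr e))].
have wsetS b w' : wset (b :: w') = wset w' `&` (if b then gen_set (size w') else ~` gen_set (size w')).
  apply/seteqP; split=> v; rewrite /wset /=.
    by case=> + vw; split=> //; move: H; case: (b) => /asboolP.
  by case=> ->; case: b => [/asboolT ->|/asboolF ->].
(* A false bit asks for a complement, which the lattice offers only relative to one of its members;
   hence the intersection with [B]. *)
have Mw B w' : smallest (@lattice_closed G) (@basic_vertex_sets G) B ->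
    smallest (@lattice_closed G) (@basic_vertex_sets G) (B `&` wset w').
  move=> MB; elim: w' => [|b w' IHw].
    by rewrite (_ : wset [::] = setT) ?setIT //; apply/seteqP.
  by rewrite wsetS setIA; case: b; [exact: MI|rewrite -setDE; exact: MD].
elim: w => [//|b w IHw]; case: ifP => // hw; rewrite wsetS.
(* A true newest bit supplies its own generator as [B]; a false one leaves an older true bit, so the
   induction hypothesis applies. *)
case: b hw => [_|/= hw]; first by rewrite setIC; exact: Mw.
by rewrite -setDE; apply: MD => //; move: IHw; rewrite hw.
Qed.

(** Invalid words go to the empty set, so sums may run over all words of a given length. *)
Definition word_gvertex w : gvertex G := GVtx (@word_gvertex_subproof w).

Lemma word_gvertexE w : has id w -> gvset (word_gvertex w) = wset w.
Proof. by rewrite /= => ->. Qed.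

Lemma word_gvertex0 w : ~~ valid w -> word_gvertex w = gv0.
Proof.
move=> nw; apply: gvertex_inj => /=; case: ifP => // hw; exact: validN_wset.
Qed.

End Tree.

Arguments nv {G} v : simpl never.

(** * The graph and the edges emitted by each kind of node *)

Section TreeGraph.
Variable G : ultragraph.
Local Notation V := (uvertex G).
Local Notation Ed := (uedge G).

Local Notation tvertex := {w : seq bool | valid G w}.
(** A tree edge is named by its lower end, a link by an edge of the ultragraph together with a piece
    of its range. *)
Local Notation tree_edge := {w : seq bool | valid G w && valid G (behead w)}.
Local Notation link_edge := {p : Ed * seq bool | edge_word p.1 p.2}.

Fact tree_edge_valid (x : tree_edge) : valid G (val x).
Proof. by case: x => w /= /andP []. Qed.
Fact tree_edge_valid_behead (x : tree_edge) : valid G (behead (val x)).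
Proof. by case: x => w /= /andP []. Qed.
Fact link_edge_valid (x : link_edge) : valid G (val x).2.
Proof. by case: x => p /= /and3P []. Qed.

Definition tree_child (x : tree_edge) : tvertex := exist _ (val x) (tree_edge_valid x).
Definition tree_parent (x : tree_edge) : tvertex :=
  exist _ (behead (val x)) (tree_edge_valid_behead x).

Definition edge_range (x : tree_edge + link_edge) : tvertex :=
  match x with
  | inl t => if isolated G (behead (val t)) then tree_parent t else tree_child t
  | inr l => exist _ (val l).2 (link_edge_valid l)
  end.
Definition edge_source (x : tree_edge + link_edge) : tvertex :=
  match x with
  | inl t => if isolated G (behead (val t)) then tree_child t else tree_parent t
  | inr l => exist _ (nv (us (val l).1)) (valid_nv _)
  end.

(* [wset w] splits into the sets of its children, so open nodes emit edges to their
  children.  Once [w] is the word of a vertex v, the node must emit the edges of v,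
  so from there on the tree edges point upwards. *)
Definition tree_graph : graph :=
  @Graph tvertex (tree_edge + link_edge)%type edge_range edge_source.

Section Total.
Variable Z : nmodType.
(** Extension by zero from the subtypes to raw words, which frees sums over a level from validity
    proofs. *)
Definition at_vertex (F : tvertex -> Z) (w : seq bool) : Z := oapp F 0 (insub w).
Definition at_tree (F : tree_edge + link_edge -> Z) (w : seq bool) : Z :=
  oapp (F \o inl) 0 (insub w).
Definition at_link (F : tree_edge + link_edge -> Z) (e : Ed) (w : seq bool) : Z :=
  oapp (F \o inr) 0 (insub (e, w)).

Lemma at_vertexT F (x : tvertex) : at_vertex F (val x) = F x.
Proof. by rewrite /at_vertex valK. Qed.
Lemma at_vertexN F w : ~~ valid G w -> at_vertex F w = 0.
Proof. by move=> nw; rewrite /at_vertex insubN. Qed.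
Lemma at_treeT F (x : tree_edge) : at_tree F (val x) = F (inl x).
Proof. by rewrite /at_tree valK. Qed.
Lemma at_treeN F w : ~~ (valid G w && valid G (behead w)) -> at_tree F w = 0.
Proof. by move=> nw; rewrite /at_tree insubN. Qed.
Lemma at_linkT F (x : link_edge) : at_link F (val x).1 (val x).2 = F (inr x).
Proof. by rewrite /at_link -surjective_pairing valK. Qed.
Lemma at_linkN F e w : ~~ edge_word e w -> at_link F e w = 0.
Proof. by move=> nw; rewrite /at_link insubN. Qed.

Definition out (x : tvertex) : set (tree_edge + link_edge) := [set f | edge_source f = x].

(** Links and reversed tree edges start at isolated nodes, so an open node emits only the edges to
    its valid children. *)
Lemma out_openE (x : tvertex) : ~~ isolated G (val x) ->
  out x = [set` map inl (pmap insub [:: false :: val x; true :: val x] : seq tree_edge)].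
Proof.
move=> nc; apply/seteqP; split=> [[t|l]|f].
- move=> xE; apply: map_f; rewrite mem_pmap_sub.
  have: tree_parent t = x.
    move: xE; rewrite /out /mkset /edge_source; case: ifP => // ct tx.
    by case/negP: nc; rewrite -tx; exact: isolated_behead.
  move=> <-; rewrite /= !inE; case: t {xE} => -[|[] w] /= p; rewrite ?eqxx ?orbT //.
- by move=> lx; case/negP: nc; rewrite -(lx : edge_source (inr l) = x); exact: isolated_nv.
- rewrite /mkset => /mapP [t]; rewrite mem_pmap_sub !inE => tx ->.
  have bt : behead (val t) = val x by case/orP: tx => /eqP ->.
  by rewrite /out /mkset /edge_source bt (negbTE nc); apply: val_inj.
Qed.

Lemma out_open (x : tvertex) (F : tree_edge + link_edge -> Z) : ~~ isolated G (val x) ->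
  \sum_(f \in out x) F f = at_tree F (false :: val x) + at_tree F (true :: val x).
Proof.
move=> nc; rewrite out_openE // -fsbig_seq; last first.
  by rewrite map_inj_uniq ?pmap_sub_uniq //; move=> ? ? [].
rewrite big_map /at_tree /=.
by do 2 case: insub => [?|] /=; rewrite !(big_cons, big_nil) /= ?addr0 ?add0r.
Qed.

(** A downward tree edge starts at an open node and a link at a node with open parent; under an
    isolated parent only the reversed edge remains. *)
Lemma out_isolatedE (t : tree_edge) : isolated G (behead (val t)) ->
  out (tree_child t) = [set inl t].
Proof.
move=> ct; apply/seteqP; split=> [[t'|l]|f ->]; rewrite /out /mkset /edge_source; last by rewrite ct.
- case: ifP => [_ [tt']|nct /(congr1 val) /= tt']; first by congr inl; apply: val_inj.
  by case/negP: nct; rewrite tt'; exact: isolated_behead.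
- by move=> /(congr1 val) /= lt; have := nv_behead_open (us (val l).1); rewrite lt ct.
Qed.

Lemma out_isolated (t : tree_edge) (F : tree_edge + link_edge -> Z) :
  isolated G (behead (val t)) -> \sum_(f \in out (tree_child t)) F f = F (inl t).
Proof. by move=> ct; rewrite out_isolatedE // fsbig_set1. Qed.

Definition nvertex (v : V) : tvertex := exist _ (nv v) (valid_nv v).

Lemma out_nvP (v : V) f : out (nvertex v) f <->
  exists2 l : link_edge, f = inr l & us (val l).1 = v.
Proof.
split=> [|[l -> <-]]; last exact: val_inj.
case: f => [t|l]; last by move=> /(congr1 val) /= lv; exists l => //; exact: nv_inj lv.
rewrite /out /mkset /edge_source; case: ifP => [ct|nct] /(congr1 val) /= tv.
  by have := nv_behead_open v; rewrite -tv ct.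
by have := isolated_nv v; rewrite -tv nct.
Qed.

(** Each edge gives at least one link, its range being nonempty, and at most as many as there are
    words of length [(eidx e).+1]. *)
Lemma out_nv_finite (v : V) :
  finite_set (out (nvertex v)) <-> finite_set [set e : Ed | us e = v].
Proof.
split=> [fin|/finite_seqP [s sv]].
  pose g (f : tree_edge + link_edge) := if f is inr l then Some (val l).1 else None.
  have : finite_set (Some @^-1` (g @` out (nvertex v))).
    by apply: finite_preimage; [move=> ? ? _ _ []|exact: finite_image].
  apply: sub_finite_set => e ev; have [w ew] := edge_word_ex e.
  pose l : link_edge := exist (fun p : Ed * seq bool => edge_word p.1 p.2) (e, w) ew.
  by exists (inr l) => //; apply/out_nvP; exists l.
apply: (@sub_finite_set _ _ [set` map inr (pmap insub
   [seq (e, w) | e <- s, w <- bitseqs (eidx e).+1] : seq link_edge)]).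
  move=> f /out_nvP [l -> lv] /=; apply: map_f; rewrite mem_pmap_sub.
  apply/allpairsPdep; exists (val l).1, (val l).2; split.
  - by have : [set e : Ed | us e = v] (val l).1 by []; rewrite sv.
  - by rewrite mem_bitseqs; case: (l) => p /= /and3P [].
  - exact: surjective_pairing.
exact: finite_seq.
Qed.

Lemma out_nv_neq0 (v : V) : out (nvertex v) !=set0 <-> [set e : Ed | us e = v] !=set0.
Proof.
split=> [[f /out_nvP [l _ lv]]|[e ev]]; first by exists (val l).1.
have [w ew] := edge_word_ex e.
exists (inr (exist (fun p : Ed * seq bool => edge_word p.1 p.2) (e, w) ew)).
by apply/out_nvP; eexists.
Qed.

Lemma out_nv (v : V) (F : tree_edge + link_edge -> Z) :
  finite_set [set e : Ed | us e = v] ->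
  \sum_(f \in out (nvertex v)) F f =
  \sum_(e \in [set e : Ed | us e = v]) \sum_(w <- bitseqs (eidx e).+1) at_link F e w.
Proof.
move=> fin; have [s us_ sv] : exists2 s : seq Ed, uniq s & [set e | us e = v] = [set` s].
  move/finite_seqP: fin => [s sv]; exists (undup s); rewrite ?undup_uniq // sv.
  by apply/seteqP; split=> e /=; rewrite mem_undup.
rewrite sv -fsbig_seq //.
set r := pmap insub [seq (e, w) | e <- s, w <- bitseqs (eidx e).+1] : seq link_edge.
have -> : out (nvertex v) = [set` map inr r].
  apply/seteqP; split=> f /=.
    move=> /out_nvP [l -> lv]; apply: map_f; rewrite mem_pmap_sub.
    apply/allpairsPdep; exists (val l).1, (val l).2; split.
    - by have : [set e : Ed | us e = v] (val l).1 by []; rewrite sv.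
    - by rewrite mem_bitseqs; case: (l) => p /= /and3P [].
    - exact: surjective_pairing.
  move=> /mapP [l + ->]; rewrite mem_pmap_sub => /allpairsPdep [e [w [es _ lE]]].
  apply/out_nvP; exists l => //; rewrite lE /=.
  by have : [set` s] e by []; rewrite -sv.
rewrite -fsbig_seq; last first.
  rewrite map_inj_uniq; last by move=> ? ? [].
  apply: pmap_sub_uniq; apply: allpairs_uniq_dep => // [e _|]; first exact: bitseqs_uniq.
  by move=> [e w] [e' w'] _ _ /= [-> ->].
transitivity (\sum_(p <- [seq (e, w) | e <- s, w <- bitseqs (eidx e).+1]) at_link F p.1 p.2).
  rewrite big_map /r; elim: [seq (_, _) | _ <- _, _ <- _] => [|p ps IHp].
    by rewrite !big_nil.
  rewrite big_cons -IHp /at_link -surjective_pairing /=.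
  by case: insub => [l|] /=; rewrite ?big_cons ?add0r.
by rewrite big_allpairs_dep.
Qed.

End Total.

(** The three kinds of node, on which the summation relation takes three shapes: open nodes, nodes
    strictly below some [nv v], and the nodes [nv v]. *)
Lemma tvertex_ind (K : tvertex -> Prop) :
  (forall x, ~~ isolated G (val x) -> K x) ->
  (forall t, isolated G (behead (val t)) -> K (tree_child t)) ->
  (forall v, K (nvertex v)) -> forall x, K x.
Proof.
move=> Ko Kc Kn x; case: (boolP (isolated G (val x))) => [cx|/Ko //].
case: (boolP (isolated G (behead (val x)))) => [cbx|ncbx].
  have vb : valid G (behead (val x)).
    by case: x cx cbx => -[//|b w] /= vw _ cw; exact: valid_behead vw (isolated_has cw).
  have vx : valid G (val x) && valid G (behead (val x)) by rewrite vb andbT; case: (x).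
  have := Kc (exist _ (val x) vx) cbx.
  by congr K; apply: val_inj.
have [v xv] := isolated_openP (valP x) cx ncbx.
by have := Kn v; congr K; apply: val_inj.
Qed.

End TreeGraph.

(** * From Leavitt families of the graph to Leavitt families of the ultragraph *)

Section FromGraph.
Variables (R : comPzRingType) (G : ultragraph) (A : rngAlgType R).
Variable F : graph_gen (tree_graph G) -> A.
Hypothesis lF : is_leavitt_family F.
Local Notation E := (tree_graph G).
Local Notation Q := (F \o @GVertex E).
Local Notation T := (F \o @GEdge E).
Local Notation Ts := (F \o @GGhost E).
Local Notation tree_edge := {w : seq bool | valid G w && valid G (behead w)}.

Definition vproj : seq bool -> A := at_vertex Q.

(* [descend (b :: w)] goes from node [w] to its child [b :: w], whatever the orientation
  of the corresponding edge. *)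
Definition descend : seq bool -> A := at_tree (fun f =>
  if f is inl t then if isolated G (behead (val t)) then Ts f else T f else 0).
Definition ascend : seq bool -> A := at_tree (fun f =>
  if f is inl t then if isolated G (behead (val t)) then T f else Ts f else 0).

Lemma vprojN w : ~~ valid G w -> vproj w = 0.
Proof. exact: at_vertexN. Qed.

Lemma vprojE w (vw : valid G w) : vproj w = Q (exist _ w vw).
Proof. by rewrite /vproj -(at_vertexT Q (exist _ w vw)). Qed.

Lemma vprojM w w' : vproj w ** vproj w' = if w == w' then vproj w else 0.
Proof.
case: (boolP (valid G w)) => [vw|nw]; last by rewrite vprojN // rmul0 if_same.
case: (boolP (valid G w')) => [vw'|nw'].
  by rewrite !vprojE (LP1 lF).
by rewrite (vprojN nw') rmulr0; case: eqP => // ww'; rewrite ww' (negbTE nw') in vw.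
Qed.

Lemma tree_wordP b w : has id w -> valid G (b :: w) ->
  exists2 x : tree_edge, val x = b :: w & behead (val x) = w.
Proof.
move=> hw vbw; have p : valid G (b :: w) && valid G (behead (b :: w)).
  by rewrite vbw (valid_behead vbw hw).
by exists (exist (fun w => valid G w && valid G (behead w)) (b :: w) p).
Qed.

Lemma descendN w : ~~ valid G w -> descend w = 0.
Proof. by move=> nw; apply: at_treeN; rewrite (negbTE nw). Qed.
Lemma ascendN w : ~~ valid G w -> ascend w = 0.
Proof. by move=> nw; apply: at_treeN; rewrite (negbTE nw). Qed.

Lemma vproj_child (x : tree_edge) : vproj (val x) = Q (tree_child x).
Proof. by rewrite (vprojE (tree_edge_valid x)). Qed.
Lemma vproj_parent (x : tree_edge) : vproj (behead (val x)) = Q (tree_parent x).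
Proof. by rewrite (vprojE (tree_edge_valid_behead x)). Qed.

Lemma descendE (x : tree_edge) :
  descend (val x) = if isolated G (behead (val x)) then Ts (inl x) else T (inl x).
Proof. by rewrite /descend at_treeT. Qed.
Lemma ascendE (x : tree_edge) :
  ascend (val x) = if isolated G (behead (val x)) then T (inl x) else Ts (inl x).
Proof. by rewrite /ascend at_treeT. Qed.

Lemma rE_tree (x : tree_edge) : rE (inl x : edge E) =
  if isolated G (behead (val x)) then tree_parent x else tree_child x.
Proof. by []. Qed.

Lemma descend_vproj b w : has id w ->
  vproj w ** descend (b :: w) = descend (b :: w) /\ descend (b :: w) ** vproj (b :: w) = descend (b :: w).
Proof.
move=> hw; case: (boolP (valid G (b :: w))) => [vbw|nbw]; last first.
  by rewrite descendN // rmul0 rmulr0.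
have [x xb xw] := tree_wordP hw vbw; rewrite -xb -xw.
rewrite descendE vproj_child vproj_parent.
have := LP2 lF (inl x : edge E) => /=.
by case: ifP => ix [? ? ? ?]; split.
Qed.

Lemma ascend_vproj b w : has id w ->
  vproj (b :: w) ** ascend (b :: w) = ascend (b :: w) /\ ascend (b :: w) ** vproj w = ascend (b :: w).
Proof.
move=> hw; case: (boolP (valid G (b :: w))) => [vbw|nbw]; last first.
  by rewrite ascendN // rmul0 rmulr0.
have [x xb xw] := tree_wordP hw vbw; rewrite -xb -xw.
rewrite ascendE vproj_child vproj_parent.
have := LP2 lF (inl x : edge E) => /=.
by case: ifP => ix [? ? ? ?]; split.
Qed.

(** The single vertex realising an isolated word dictates the next bit. *)
Lemma isolated_child_unique b b' w : isolated G w ->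
  valid G (b :: w) -> valid G (b' :: w) -> b = b'.
Proof.
move=> iw /validP [_ [u uw]] /validP [_ [v vw]].
have uv := isolated_inj iw (bits_behead uw) (bits_behead vw).
by move: uw; rewrite uv vw => -[].
Qed.

Lemma isolated_out (x : tree_edge) : isolated G (behead (val x)) ->
  Q (tree_child x) = T (inl x) ** Ts (inl x).
Proof.
move=> ix; rewrite (LP4 lF); first exact: (out_isolated (fun f => T f ** Ts f)).
  by rewrite [X in finite_set X](out_isolatedE ix); exact: finite_set1.
by rewrite [X in X !=set0](out_isolatedE ix); exists (inl x).
Qed.

(** Below an open node this is LP3. Below an isolated one the edge and its ghost have exchanged
    roles, and it is LP4 at a node emitting a single edge. *)
Lemma ascend_descend b b' w : has id w ->
  ascend (b :: w) ** descend (b' :: w) = if b == b' then vproj (b :: w) else 0.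
Proof.
move=> hw; case: (boolP (valid G (b :: w))) => [vbw|nbw]; last first.
  by rewrite ascendN // rmul0 vprojN // if_same.
case: (boolP (valid G (b' :: w))) => [vbw'|nbw']; last first.
  by rewrite descendN // rmulr0; case: eqP => // bb'; rewrite bb' (negbTE nbw') in vbw.
have [x xb xw] := tree_wordP hw vbw; have [y yb yw] := tree_wordP hw vbw'.
rewrite -xb -yb ascendE descendE xw yw; case: ifP => iw.
  have bb' := isolated_child_unique iw vbw vbw'.
  have -> : y = x by apply: val_inj; rewrite yb xb bb'.
  by rewrite bb' eqxx vproj_child isolated_out ?xw.
rewrite (LP3 lF); have -> : ((inl x : edge E) == inl y) = (b == b').
  by rewrite -[RHS]andbT -(eqxx w) -[RHS]/(b :: w == b' :: w) -xb -yb.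
by case: eqP => // bb'; rewrite rE_tree xw iw vproj_child.
Qed.

(** Dual to [ascend_descend]: LP4 at an open node, and LP3 at an isolated one, where just one child
    is valid and the other term vanishes. *)
Lemma vproj_split w : has id w ->
  vproj w = descend (false :: w) ** ascend (false :: w) + descend (true :: w) ** ascend (true :: w).
Proof.
move=> hw; case: (boolP (valid G w)) => [vw|nw]; last first.
  have nbw b : ~~ valid G (b :: w) by apply: contra nw => /valid_behead; apply.
  by rewrite !descendN // !rmul0 addr0 vprojN.
(* Any vertex realising [w] selects a valid child by its next bit. *)
have [_ [v vE]] := validP _ _ vw; pose b := `[< gen_set (size w) v >].
have vbw : valid G (b :: w).
  by apply/validP; split; [rewrite /= hw orbT|exists v; rewrite /= vE].
case: (boolP (isolated G w)) => iw.
  have [x xb xw] := tree_wordP hw vbw.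
  have e : vproj w = descend (b :: w) ** ascend (b :: w).
    by rewrite -xb descendE ascendE xw iw (LP3 lF) eqxx rE_tree xw iw -vproj_parent xw.
  have nb : ~~ valid G (~~ b :: w).
    by apply/negP => vbw'; have := isolated_child_unique iw vbw vbw'; case: (b).
  rewrite {1}e; case: (b) nb => /= /descendN ->; by rewrite rmul0 ?addr0 ?add0r.
pose x : vertex E := exist _ w vw.
have nfin : out x = _ := out_openE (iw : ~~ isolated G (val x)).
have [y yb yw] := tree_wordP hw vbw.
rewrite (vprojE vw) (LP4 lF).
- rewrite [LHS](out_open (fun f => T f ** Ts f) (iw : ~~ isolated G (val x))) /=.
  have tE c : at_tree (fun f => T f ** Ts f) (c :: w) = descend (c :: w) ** ascend (c :: w).
    case: (boolP (valid G (c :: w))) => [vc|nc].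
      by have [z <- zw] := tree_wordP hw vc; rewrite at_treeT descendE ascendE zw (negbTE iw).
    by rewrite descendN // rmul0 at_treeN // (negbTE nc).
  by rewrite !tE.
- by rewrite [X in finite_set X]nfin; exact: finite_seq.
- exists (inl y); rewrite /= yw (negbTE iw); exact: val_inj.
Qed.

(* The path from the topmost node above [w] down to [w]; [J w ** Js w] is the projection that
  the ultragraph algebra attaches to [wset w]. *)
Fixpoint path_to (w : seq bool) : A :=
  if w is b :: w' then if has id w' then path_to w' ** descend w else vproj w else 0.
Fixpoint path_from (w : seq bool) : A :=
  if w is b :: w' then if has id w' then ascend w ** path_from w' else vproj w else 0.
Local Notation J := path_to.
Local Notation Js := path_from.

Lemma path_to_vproj w : J w ** vproj w = J w.
Proof.
case: w => [|b w] /=; first by rewrite rmul0.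
case: ifP => hw; last by rewrite vprojM eqxx.
by rewrite -rng_mulA (descend_vproj b hw).2.
Qed.

Lemma vproj_path_from w : vproj w ** Js w = Js w.
Proof.
case: w => [|b w] /=; first by rewrite rmulr0.
case: ifP => hw; last by rewrite vprojM eqxx.
by rewrite rng_mulA (ascend_vproj b hw).1.
Qed.

Lemma path_toN w : ~~ valid G w -> J w = 0.
Proof. by move=> nw; rewrite -path_to_vproj vprojN // rmulr0. Qed.

(** On the right [Js w] is supported at the apex of [w], a node no longer than [w] and so different
    from [u]. *)
Lemma path_from_long w u : (size w < size u)%N -> Js w ** vproj u = 0.
Proof.
elim: w => [|b w IHw] /= lwu; first by rewrite rmul0.
case: ifP => hw; first by rewrite -rng_mulA IHw ?rmulr0 //; exact: ltn_trans lwu.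
by rewrite vprojM; case: eqP => // wu; rewrite -wu ltnn in lwu.
Qed.

Lemma long_path_to w u : (size w < size u)%N -> vproj u ** J w = 0.
Proof.
elim: w => [|b w IHw] /= lwu; first by rewrite rmulr0.
case: ifP => hw; first by rewrite rng_mulA IHw ?rmul0 //; exact: ltn_trans lwu.
by rewrite vprojM; case: eqP => // wu; rewrite wu ltnn in lwu.
Qed.

(** The inner factors cancel from the top down until the words differ, where [ascend_descend] gives
    0. If only one of two compared words is an apex, the path of the other starts at a shorter node
    and the product is 0 as well. *)
Lemma path_from_to w w' : size w = size w' -> Js w ** J w' = if w == w' then vproj w else 0.
Proof.
elim: w w' => [|b w IHw] [|b' w'] //=; first by rewrite rmul0 vprojN.
move=> [sw]; case: ifP => hw; case: ifP => hw'.
- rewrite rng_mulA -[_ ** Js w ** J w']rng_mulA IHw //.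
  rewrite eqseq_cons; case: eqP => [ww'|_]; last by rewrite andbF rmulr0 rmul0.
  by rewrite (ascend_vproj b hw).2 -ww' andbT ascend_descend.
- rewrite -rng_mulA path_from_long ?rmulr0 /= ?sw //.
  by rewrite eqseq_cons; case: eqP; case: eqP => // ww'; rewrite ww' hw' in hw.
- rewrite rng_mulA long_path_to ?rmul0 /= ?sw //.
  by rewrite eqseq_cons; case: eqP; case: eqP => // ww'; rewrite ww' hw' in hw.
- by rewrite vprojM.
Qed.

Definition wproj w : A := J w ** Js w.

Lemma wprojN w : ~~ valid G w -> wproj w = 0.
Proof. by move=> nw; rewrite /wproj path_toN // rmul0. Qed.

Lemma wprojM w w' : size w = size w' -> wproj w ** wproj w' = if w == w' then wproj w else 0.
Proof.
move=> sw; rewrite /wproj rng_mulA -[_ ** Js w ** J w']rng_mulA path_from_to //.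
by case: eqP => [<-|_]; rewrite ?path_to_vproj // rmulr0 rmul0.
Qed.

Lemma wproj_split w : has id w -> wproj w = wproj (false :: w) + wproj (true :: w).
Proof.
move=> hw; rewrite /wproj -{1}[J w]path_to_vproj /= hw vproj_split // rng_mulDr rng_mulDl.
by rewrite !rng_mulA.
Qed.

Lemma wproj_path w : wproj w ** J w = J w.
Proof. by rewrite /wproj -rng_mulA path_from_to // eqxx path_to_vproj. Qed.
Lemma path_wproj w : Js w ** wproj w = Js w.
Proof. by rewrite /wproj rng_mulA path_from_to // eqxx vproj_path_from. Qed.

Definition level_proj (B : set (uvertex G)) (n : nat) : A :=
  \sum_(w <- bitseqs n | hits B w) wproj w.
Definition gproj (B : gvertex G) : A := level_proj B (glevel B).

(** Measurability provides the true bit without which [wproj_split] fails, and it places every valid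
    child of a word in [B] inside [B] again. *)
Lemma level_projS B n : meas B n -> level_proj B n = level_proj B n.+1.
Proof.
move=> mB; rewrite /level_proj [RHS]big_mkcond big_bitseqsS /= [LHS]big_mkcond /=.
apply: eq_big_seq => w; rewrite mem_bitseqs => /eqP sw.
case: ifP => [/asboolP [v Bv vw]|/negP nBw]; last first.
  have nbw b : hits B (b :: w) = false.
    by apply/negP => /asboolP [v Bv vw]; apply: nBw; apply/asboolP; exists v => //; case: vw.
  by rewrite !nbw addr0.
have [hw _] : has id (bits v n) /\ B v by exact: mB.
rewrite -sw vw in hw; rewrite wproj_split //.
have e b : wproj (b :: w) = if hits B (b :: w) then wproj (b :: w) else 0.
  case: ifP => // /negP nB; apply: wprojN; apply/negP => /validP [_ [u uw]].
  apply: nB; apply/asboolP; exists u => //.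
  apply: (proj2 (mB v u _ Bv)); rewrite -sw vw.
  by case: uw.
by rewrite -!e.
Qed.

Lemma level_proj_leq B m n : (m <= n)%N -> meas B m -> level_proj B m = level_proj B n.
Proof.
move=> /subnK <- mB; elim: (n - m)%N => //= k ->; rewrite level_projS //.
by apply: meas_leq mB; exact: leq_addl.
Qed.

Lemma gprojE (B : gvertex G) n : meas B n -> gproj B = level_proj B n.
Proof.
move=> mB; rewrite /gproj (level_proj_leq (leq_maxl (glevel B) n) (@glevelP _ B)).
by rewrite -(level_proj_leq (leq_maxr (glevel B) n) mB).
Qed.

Lemma level_proj_wset w : level_proj (wset w) (size w) = wproj w.
Proof.
rewrite /level_proj big_mkcond /= (bigD1_seq w) ?bitseqs_uniq ?mem_bitseqs //=.
rewrite big1_seq ?addr0 => [|w' /andP [ww']].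
  case: ifP => // /negP nw; rewrite wprojN //; apply/negP => /validP [_ [v vw]].
  by apply: nw; apply/asboolP; exists v.
rewrite mem_bitseqs => /eqP sw'; case: ifP => // /asboolP [v wv vw'].
by move: ww'; rewrite -vw' -[in X in _ != X]wv sw' eqxx.
Qed.

Lemma gproj_word w : valid G w -> gproj (word_gvertex G w) = wproj w.
Proof.
move=> /validP [hw _]; rewrite (@gprojE _ (size w)) ?word_gvertexE //.
  exact: level_proj_wset.
exact: meas_wset.
Qed.

Lemma gproj_gv1 v : gproj (gv1 v) = wproj (nv v).
Proof.
by rewrite -gproj_word ?valid_nv //; congr gproj; apply: gvertex_inj;
   rewrite word_gvertexE ?wset_nv //; have /validP [] := valid_nv v.
Qed.

Lemma level_projM (B C : set (uvertex G)) n : meas B n ->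
  level_proj (B `&` C) n = level_proj B n ** level_proj C n.
Proof.
move=> mB; rewrite /level_proj rmul_suml big_mkcond [RHS]big_mkcond /=.
apply: eq_big_seq => w; rewrite mem_bitseqs => /eqP sw.
(* Measurability of [B] moves the witness for [C] into [B]. *)
have -> : hits (B `&` C) w = hits B w && hits C w.
  apply/asboolP/andP => [[v [Bv Cv] vw]|[/asboolP [u Bu uw] /asboolP [v Cv vw]]].
    by split; apply/asboolP; exists v.
  by exists v => //; split=> //; apply: (proj2 (mB u v _ Bu)); rewrite -sw uw vw.
case: (hits B w) => //=.
rewrite rmul_sumr big_mkcond [RHS](bigD1_seq w) ?bitseqs_uniq ?mem_bitseqs ?sw //=.
rewrite big1_seq ?addr0 => [|w' /andP [ww']]; first by rewrite wprojM // eqxx.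
rewrite mem_bitseqs => /eqP sw'; case: ifP => // _; rewrite wprojM ?sw //.
by rewrite eq_sym (negbTE ww').
Qed.

Lemma level_projU (B C : set (uvertex G)) n : meas B n ->
  level_proj (B `|` C) n = level_proj B n + level_proj C n - level_proj (B `&` C) n.
Proof.
move=> mB; rewrite /level_proj !big_mkcond /=.
transitivity (\sum_(w <- bitseqs n) ((if hits B w then wproj w else 0) +
  (if hits C w then wproj w else 0) - (if hits (B `&` C) w then wproj w else 0)));
  last by rewrite sumrB big_split /= -!big_mkcond.
apply: eq_big_seq => w; rewrite mem_bitseqs => /eqP sw.
have -> : hits (B `&` C) w = hits B w && hits C w.
  apply/asboolP/andP => [[v [Bv Cv] vw]|[/asboolP [u Bu uw] /asboolP [v Cv vw]]].
    by split; apply/asboolP; exists v.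
  by exists v => //; split=> //; apply: (proj2 (mB u v _ Bu)); rewrite -sw uw vw.
have -> : hits (B `|` C) w = hits B w || hits C w.
  apply/asboolP/orP => [[v [Bv|Cv] vw]|[/asboolP [u Bu uw]|/asboolP [v Cv vw]]].
  - by left; apply/asboolP; exists v.
  - by right; apply/asboolP; exists v.
  - by exists u => //; left.
  - by exists v => //; right.
by case: (hits B w); case: (hits C w); rewrite /= ?addr0 ?add0r ?subr0 ?addrK ?oppr0.
Qed.

Lemma gproj_common (B C : gvertex G) : exists n, meas B n /\ meas C n.
Proof.
exists (maxn (glevel B) (glevel C)).
by split; [apply: (meas_leq (leq_maxl _ _))|apply: (meas_leq (leq_maxr _ _))]; exact: glevelP.
Qed.

Lemma measI (B C : set (uvertex G)) n : meas B n -> meas C n -> meas (B `&` C) n.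
Proof. by move=> mB mC u v uv [/(mB _ _ uv) [hu Bv] /(mC _ _ uv)[_ Cv]]. Qed.

Lemma measU (B C : set (uvertex G)) n : meas B n -> meas C n -> meas (B `|` C) n.
Proof.
move=> mB mC u v uv [/(mB _ _ uv)|/(mC _ _ uv)] [hu ?].
  by split=> //; left.
by split=> //; right.
Qed.

Lemma gproj0 : gproj gv0 = 0.
Proof. by rewrite /gproj /level_proj big1 // => w /asboolP []. Qed.

Lemma gprojI (B C : gvertex G) : gproj (gvI B C) = gproj B ** gproj C.
Proof.
have [n [mB mC]] := gproj_common B C.
by rewrite (gprojE mB) (gprojE mC) -level_projM // (@gprojE _ n) //; exact: measI.
Qed.

Lemma gprojU (B C : gvertex G) : gproj (gvU B C) = gproj B + gproj C - gproj (gvI B C).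
Proof.
have [n [mB mC]] := gproj_common B C.
rewrite (gprojE mB) (gprojE mC) (@gprojE (gvI B C) n) ?(@gprojE (gvU B C) n).
- exact: level_projU.
- exact: measU.
- exact: measI.
Qed.

Local Notation t := (at_link T).
Local Notation ts := (at_link Ts).
(** Down to the node of [us e], along the link to a piece of [ur e], and back up from there. Words
    that are not pieces contribute 0 through [at_link]. *)
Definition uarrow (e : uedge G) : A :=
  \sum_(w <- bitseqs (eidx e).+1) J (nv (us e)) ** t e w ** Js w.
Definition ughost (e : uedge G) : A :=
  \sum_(w <- bitseqs (eidx e).+1) J w ** ts e w ** Js (nv (us e)).

Lemma gproj_gvr e : gproj (gvr e) =
  \sum_(w <- bitseqs (eidx e).+1) if edge_word e w then wproj w else 0.
Proof.
rewrite (@gprojE _ (eidx e).+1); last exact: meas_ur.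
rewrite /level_proj big_mkcond; apply: eq_big_seq => w; rewrite mem_bitseqs => /eqP sw.
suff -> : hits (gvr e) w = edge_word e w by [].
by apply/asboolP/edge_wordP => [[v]|[_ [v]]]; [split=> //; exists v|exists v].
Qed.

Lemma link_ghostM e f w w' :
  ts e w ** t f w' = if (e == f) && (w == w') && edge_word e w then vproj w else 0.
Proof.
case: (boolP (edge_word e w)) => [ew|nw]; last first.
  by rewrite at_linkN // rmul0 andbF.
case: (boolP (edge_word f w')) => [fw|nw]; last first.
  rewrite [t f w']at_linkN // rmulr0 andbT; case: eqP => // ef; case: eqP => //= ww'.
  by rewrite -ef -ww' ew in nw.
pose x : {p : uedge G * seq bool | edge_word p.1 p.2} := exist _ (e, w) ew.
pose y : {p : uedge G * seq bool | edge_word p.1 p.2} := exist _ (f, w') fw.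
have -> : ts e w = Ts (inr x) by exact: (at_linkT Ts x).
have -> : t f w' = T (inr y) by exact: (at_linkT T y).
rewrite (LP3 lF) andbT -[(e == f) && _]/((inr x : edge E) == inr y).
by case: eqP => // _; rewrite (vprojE (link_edge_valid x)).
Qed.

Lemma link_vproj e w : [/\ vproj (nv (us e)) ** t e w = t e w, t e w ** vproj w = t e w,
  vproj w ** ts e w = ts e w & ts e w ** vproj (nv (us e)) = ts e w].
Proof.
case: (boolP (edge_word e w)) => [ew|nw]; last first.
  by rewrite !at_linkN // !rmul0 !rmulr0.
pose x : {p : uedge G * seq bool | edge_word p.1 p.2} := exist _ (e, w) ew.
have -> : ts e w = Ts (inr x) by exact: (at_linkT Ts x).
have -> : t e w = T (inr x) by exact: (at_linkT T x).
rewrite (vprojE (link_edge_valid x)) (vprojE (valid_nv (us e))).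
exact: (LP2 lF (inr x : edge E)).
Qed.

Lemma wproj_nvM (u v : uvertex G) : u != v -> wproj (nv u) ** wproj (nv v) = 0.
Proof.
move=> uv; rewrite -!gproj_gv1 -gprojI -gproj0; congr gproj; apply: gvertex_inj => /=.
by rewrite -subset0 => x [/= -> uv']; rewrite uv' eqxx in uv.
Qed.

(** The two words may differ in length, so [path_from_to] does not settle distinct vertices;
    disjointness of the two singletons does. *)
Lemma path_from_to_nv (u v : uvertex G) : Js (nv u) ** J (nv v) = if u == v then vproj (nv u) else 0.
Proof.
case: eqP => [<-|/eqP uv]; first by rewrite path_from_to // eqxx.
rewrite -path_wproj -[J (nv v)]wproj_path rng_mulA -[Js _ ** _ ** _]rng_mulA.
by rewrite wproj_nvM // rmulr0 rmul0.
Qed.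

Lemma ughost_arrow e f : ughost e ** uarrow f = if e == f then gproj (gvr e) else 0.
Proof.
have key w w' : J w ** ts e w ** Js (nv (us e)) ** (J (nv (us f)) ** t f w' ** Js w')
    = if (e == f) && (w == w') && edge_word e w then wproj w else 0.
  transitivity (J w ** (ts e w ** (Js (nv (us e)) ** J (nv (us f))) ** t f w') ** Js w').
    by rewrite !rng_mulA.
  rewrite path_from_to_nv; case: eqP => [sef|nsef].
    have [_ _ _ ->] := link_vproj e w; rewrite link_ghostM.
    case: ifP => [/andP [/andP [_ /eqP <-] _]|_]; last by rewrite rmulr0 rmul0.
    by rewrite path_to_vproj.
  rewrite rmulr0 rmul0 rmulr0 rmul0; case: eqP => // ef.
  by rewrite ef in nsef.
rewrite /ughost /uarrow rmul_suml.
under eq_bigr => w _ do (rewrite rmul_sumr; under eq_bigr => w' _ do rewrite key).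
case: eqP => [ef|nef]; last by rewrite big1 // => w _; rewrite big1.
rewrite gproj_gvr -ef; apply: eq_big_seq => w wn.
rewrite (big_bitseqs_only wn) ?eqxx // => w' _ ww'.
by rewrite eq_sym (negbTE ww').
Qed.

Lemma uarrow_vertex e : gproj (gv1 (us e)) ** uarrow e = uarrow e.
Proof.
rewrite gproj_gv1 rmul_sumr; apply: eq_bigr => w _.
by rewrite !rng_mulA wproj_path.
Qed.

Lemma ughost_vertex e : ughost e ** gproj (gv1 (us e)) = ughost e.
Proof.
rewrite gproj_gv1 rmul_suml; apply: eq_bigr => w _.
by rewrite -!rng_mulA path_wproj.
Qed.

Lemma uarrow_range e : uarrow e ** gproj (gvr e) = uarrow e.
Proof.
rewrite gproj_gvr rmul_suml; apply: eq_big_seq => w wn; rewrite rmul_sumr.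
rewrite (big_bitseqs_only wn) => [|w' w'n ww'].
  case: (boolP (edge_word e w)) => ew; first by rewrite -rng_mulA path_wproj.
  by rewrite [t e w]at_linkN // !(rmulr0, rmul0).
case: ifP => _; last by rewrite rmulr0.
have sw : size w = size w' by move: wn w'n; rewrite !mem_bitseqs => /eqP -> /eqP ->.
rewrite /wproj rng_mulA -[_ ** Js w ** J w']rng_mulA (path_from_to sw).
by rewrite eq_sym (negbTE ww') !(rmulr0, rmul0).
Qed.

Lemma ughost_range e : gproj (gvr e) ** ughost e = ughost e.
Proof.
rewrite gproj_gvr rmul_sumr; apply: eq_big_seq => w wn; rewrite rmul_suml.
rewrite (big_bitseqs_only wn) => [|w' w'n ww'].
  case: (boolP (edge_word e w)) => ew; first by rewrite !rng_mulA wproj_path.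
  by rewrite [ts e w]at_linkN // !(rmulr0, rmul0).
case: ifP => _; last by rewrite rmul0.
have sw : size w' = size w by move: wn w'n; rewrite !mem_bitseqs => /eqP -> /eqP ->.
rewrite /wproj -!rng_mulA [Js w' ** _]rng_mulA (path_from_to sw).
by rewrite (negbTE ww') !(rmulr0, rmul0).
Qed.

Lemma uarrow_ghost e : uarrow e ** ughost e =
  J (nv (us e)) ** (\sum_(w <- bitseqs (eidx e).+1) t e w ** ts e w) ** Js (nv (us e)).
Proof.
rewrite rmul_suml rmul_sumr rmul_suml; apply: eq_big_seq => w wn; rewrite rmul_sumr.
have key w' : w' \in bitseqs (eidx e).+1 ->
    J (nv (us e)) ** t e w ** Js w ** (J w' ** ts e w' ** Js (nv (us e))) =
    if w == w' then J (nv (us e)) ** (t e w ** ts e w) ** Js (nv (us e)) else 0.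
  move=> w'n; have sw : size w = size w'.
    by move: wn w'n; rewrite !mem_bitseqs => /eqP -> /eqP ->.
  transitivity (J (nv (us e)) ** (t e w ** (Js w ** J w') ** ts e w') ** Js (nv (us e))).
    by rewrite !rng_mulA.
  rewrite path_from_to //; case: eqP => [<-|_]; last by rewrite rmulr0 rmul0 rmulr0 rmul0.
  by have [_ -> _ _] := link_vproj e w.
rewrite (big_bitseqs_only wn) ?key ?eqxx // => w' w'n ww'.
by rewrite key // eq_sym (negbTE ww').
Qed.

(** This is LP4 at the node [nv v], conjugated by the path down to it: that node emits exactly the
    links of the edges leaving [v]. *)
Lemma vertex_split v : finite_set [set e | us e = v] -> [set e | us e = v] !=set0 ->
  gproj (gv1 v) = \sum_(e \in [set e | us e = v]) uarrow e ** ughost e.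
Proof.
move=> fin ne; rewrite gproj_gv1 /wproj -path_to_vproj (vprojE (valid_nv v)) (LP4 lF).
- rewrite [X in J _ ** X](out_nv (fun f => T f ** Ts f) fin) !fsbig_finite //=.
  rewrite rmul_sumr rmul_suml; apply: eq_big_seq => e.
  rewrite in_fset_set // => /set_mem /= ev; rewrite uarrow_ghost ev.
  congr (_ ** _ ** _); apply: eq_bigr => w _.
  case: (boolP (edge_word e w)) => ew; last by rewrite !at_linkN // rmul0.
  pose x : {p : uedge G * seq bool | edge_word p.1 p.2} := exist _ (e, w) ew.
  have eT (H : edge E -> A) : at_link H e w = H (inr x) by exact: (at_linkT H x).
  by rewrite !eT.
- exact/out_nv_finite.
- exact/out_nv_neq0.
Qed.

Lemma path_to_vprojM x w : J x ** vproj w = if x == w then J x else 0.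
Proof.
rewrite -{1}[J x]path_to_vproj -rng_mulA vprojM; case: eqP => _; last by rewrite rmulr0.
exact: path_to_vproj.
Qed.

(** Here and in the next three lemmas a path is pushed through a generator; the product is again a
    path, up to a left factor from the ultragraph family. This makes [n] |-> ([J w n]) commute with
    L(E). *)
Lemma path_descend x b w : has id w ->
  J x ** descend (b :: w) = if x == w then J (b :: w) else 0.
Proof.
move=> hw; rewrite -(descend_vproj b hw).1 rng_mulA path_to_vprojM.
by case: eqP => [->|_]; rewrite ?rmul0 //= hw.
Qed.

Lemma path_ascend x b w : has id w ->
  J x ** ascend (b :: w) = if x == b :: w then wproj (b :: w) ** J w else 0.
Proof.
move=> hw; rewrite -(ascend_vproj b hw).1 rng_mulA path_to_vprojM.
case: eqP => [->|_]; last by rewrite rmul0.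
by rewrite /wproj -rng_mulA /= hw -[ascend _ ** _ ** _]rng_mulA path_from_to // eqxx
  (ascend_vproj b hw).2.
Qed.

Lemma path_link x e w : edge_word e w ->
  J x ** t e w = if x == nv (us e) then uarrow e ** J w else 0.
Proof.
move=> ew; have [tl _ _ _] := link_vproj e w; rewrite -tl rng_mulA path_to_vprojM.
case: eqP => [->|_]; last by rewrite rmul0.
have wn : w \in bitseqs (eidx e).+1 by rewrite mem_bitseqs; case/and3P: ew.
rewrite rmul_suml (big_bitseqs_only wn) => [|w' w'n ww'].
  by rewrite -rng_mulA path_from_to // eqxx -rng_mulA; have [_ -> _ _] := link_vproj e w.
have sw : size w' = size w by move: wn w'n; rewrite !mem_bitseqs => /eqP -> /eqP ->.
by rewrite -rng_mulA path_from_to // (negbTE ww') rmulr0.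
Qed.

Lemma path_ghost x e w : edge_word e w ->
  J x ** ts e w = if x == w then wproj w ** ughost e ** J (nv (us e)) else 0.
Proof.
move=> ew; have [_ _ tl _] := link_vproj e w; rewrite -tl rng_mulA path_to_vprojM.
case: eqP => [->|_]; last by rewrite rmul0.
have wn : w \in bitseqs (eidx e).+1 by rewrite mem_bitseqs; case/and3P: ew.
rewrite rmul_sumr (big_bitseqs_only wn) => [|w' w'n ww'].
  rewrite !rng_mulA wproj_path -[_ ** Js _ ** J _]rng_mulA path_from_to_nv eqxx.
  by rewrite -rng_mulA; have [_ _ _ ->] := link_vproj e w.
have sw : size w = size w' by move: wn w'n; rewrite !mem_bitseqs => /eqP -> /eqP ->.
by rewrite !rng_mulA /wproj -[_ ** Js w ** J w']rng_mulA path_from_to // eq_sym (negbTE ww')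
  !(rmulr0, rmul0).
Qed.

Lemma gproj_word_gvertex w : gproj (word_gvertex G w) = wproj w.
Proof.
case: (boolP (valid G w)) => [|nw]; first exact: gproj_word.
by rewrite word_gvertex0 // gproj0 wprojN.
Qed.

Lemma path_to_from x w : x != w -> J x ** Js w = 0.
Proof.
by move=> xw; rewrite -vproj_path_from rng_mulA path_to_vprojM (negbTE xw) rmul0.
Qed.

Lemma tree_edgeE (x : tree_edge) :
  T (inl x) = (if isolated G (behead (val x)) then ascend (val x) else descend (val x)) /\
  Ts (inl x) = if isolated G (behead (val x)) then descend (val x) else ascend (val x).
Proof. by rewrite descendE ascendE; case: (isolated _ _). Qed.

Definition ultra_of_graph (g : ultragraph_gen G) : A :=
  match g with UVertex B => gproj B | UEdge e => uarrow e | UGhost e => ughost e end.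

Lemma ultra_of_graph_family : is_ultra_leavitt_family ultra_of_graph.
Proof.
split=> /= [|e|e f|v fin ne].
- by split; [exact: gproj0|exact: gprojI|exact: gprojU].
- by split; [exact: uarrow_vertex|exact: uarrow_range|exact: ughost_range|exact: ughost_vertex].
- exact: ughost_arrow.
- exact: vertex_split.
Qed.

End FromGraph.

(** * From Leavitt families of the ultragraph to Leavitt families of the graph *)

Section FromUltra.
Variables (R : comPzRingType) (G : ultragraph) (S : rngAlgType R).
Variable H : ultragraph_gen G -> S.
Hypothesis lH : is_ultra_leavitt_family H.
Local Notation P := (H \o @UVertex G).
Local Notation s := (H \o @UEdge G).
Local Notation ss := (H \o @UGhost G).

Definition word_proj (w : seq bool) : S := P (word_gvertex G w).
Local Notation p := word_proj.

Lemma fam0 : P gv0 = 0.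
Proof. by have [[]] := lH. Qed.
Lemma famI (B C : gvertex G) : P (gvI B C) = P B ** P C.
Proof. by have [[]] := lH. Qed.
Lemma famU (B C : gvertex G) : P (gvU B C) = P B + P C - P (gvI B C).
Proof. by have [[]] := lH. Qed.

Lemma fam_subl (B C : gvertex G) : B `<=` C -> P B ** P C = P B.
Proof.
by move=> BC; rewrite -famI; congr P; apply: gvertex_inj; rewrite /= (setIidl BC).
Qed.

Lemma fam_subr (B C : gvertex G) : B `<=` C -> P C ** P B = P B.
Proof.
by move=> BC; rewrite -famI; congr P; apply: gvertex_inj; rewrite /= (setIidr BC).
Qed.

Lemma fam_disj (B C : gvertex G) : (forall x, gvset B x -> gvset C x -> False) -> P B ** P C = 0.
Proof.
move=> BC; rewrite -famI -fam0; congr P; apply: gvertex_inj.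
by rewrite -subset0 => x [/BC].
Qed.

Lemma word_projN w : ~~ valid G w -> p w = 0.
Proof. by move=> nw; rewrite /word_proj word_gvertex0 // fam0. Qed.

Lemma word_gvertexP w x : gvset (word_gvertex G w) x <-> has id w /\ bits x (size w) = w.
Proof. by rewrite /=; case: ifP => hw; split=> // -[]. Qed.

Lemma word_proj_disj w w' : size w = size w' -> w != w' -> p w ** p w' = 0.
Proof.
move=> sw /eqP ww'; apply: fam_disj => x /word_gvertexP [_ xw] /word_gvertexP [_ xw'].
by apply: ww'; rewrite -xw sw.
Qed.

Lemma word_projK w : p w ** p w = p w.
Proof. exact: fam_subl. Qed.

Lemma word_proj_child b w : has id w -> p w ** p (b :: w) = p (b :: w) /\ p (b :: w) ** p w = p (b :: w).
Proof.
move=> hw; have sub : word_gvertex G (b :: w) `<=` word_gvertex G w.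
  by move=> x /word_gvertexP [_ [_ xw]]; apply/word_gvertexP.
by split; [exact: fam_subr|exact: fam_subl].
Qed.

Definition words_gvertex (ws : seq (seq bool)) : gvertex G :=
  foldr (fun w B => gvU (word_gvertex G w) B) gv0 ws.

Lemma words_gvertexP ws x :
  gvset (words_gvertex ws) x <-> exists2 w, w \in ws & gvset (word_gvertex G w) x.
Proof.
elim: ws => [|w ws IHws]; first by split=> [//|[w]]; rewrite in_nil.
split=> [[wx|/IHws [w' w'ws wx]]|[w']].
- by exists w; rewrite ?mem_head.
- by exists w' => //; rewrite inE w'ws orbT.
- by rewrite inE => /orP [/eqP ->|w'ws wx]; [left|right; apply/IHws; exists w'].
Qed.

Lemma words_gvertex_sum ws n : uniq ws -> {subset ws <= bitseqs n} ->
  P (words_gvertex ws) = \sum_(w <- ws) p w.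
Proof.
elim: ws => [_ _|w ws IHws]; first by rewrite big_nil fam0.
move=> /andP [wws uws] sws; rewrite big_cons -IHws //; last first.
  by move=> w' w'ws; apply: sws; rewrite inE w'ws orbT.
rewrite [LHS]famU famI [X in _ - X]fam_disj ?subr0 // => x /word_gvertexP [_ xw] /words_gvertexP [w' w'ws].
move=> /word_gvertexP [_ xw']; case/negP: wws.
have := sws w' _; rewrite inE w'ws orbT mem_bitseqs => /(_ isT) /eqP sw'.
have := sws w _; rewrite inE eqxx mem_bitseqs => /(_ isT) /eqP sw.
by rewrite -xw sw -sw' xw'.
Qed.

(** At a level where it is measurable, [B] is the disjoint union of the word sets it meets, and the
    family is additive on disjoint unions. *)
Lemma fam_level (B : gvertex G) n : meas B n ->
  P B = \sum_(w <- bitseqs n | hits B w) p w.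
Proof.
move=> mB; rewrite -big_filter -(@words_gvertex_sum _ n); last first.
- by move=> w; rewrite mem_filter => /andP [].
- exact/filter_uniq/bitseqs_uniq.
congr P; apply: gvertex_inj; apply/seteqP; split=> x.
  move=> Bx; apply/words_gvertexP; exists (bits x n).
    rewrite mem_filter mem_bitseqs size_bits eqxx andbT.
    by apply/asboolP; exists x; rewrite ?size_bits.
  by apply/word_gvertexP; rewrite size_bits; split=> //; case: (mB x x erefl Bx).
move=> /words_gvertexP [w]; rewrite mem_filter mem_bitseqs => /andP [/asboolP [v Bv vw] /eqP sw].
move=> /word_gvertexP [_ xw]; apply: (proj2 (mB v x _ Bv)).
by rewrite -sw vw xw.
Qed.

Lemma fam_gvr e : P (gvr e) =
  \sum_(w <- bitseqs (eidx e).+1) if edge_word e w then p w else 0.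
Proof.
rewrite (@fam_level (gvr e) _ (@meas_ur _ e)) big_mkcond; apply: eq_big_seq => w; rewrite mem_bitseqs => /eqP sw.
suff -> : hits (gvr e) w = edge_word e w by [].
by apply/asboolP/edge_wordP => [[v]|[_ [v]]]; [split=> //; exists v|exists v].
Qed.

Lemma word_proj_split w : has id w -> p w = p (false :: w) + p (true :: w).
Proof.
move=> hw; rewrite -[RHS]subr0 -(@word_proj_disj (false :: w) (true :: w)) // -famI -famU.
congr P; apply: gvertex_inj; apply/seteqP; split=> x.
  move=> /word_gvertexP [_ xw]; case: (boolP `[< gen_set (size w) x >]) => xs; [right|left];
  by apply/word_gvertexP; split; [rewrite /= ?hw|rewrite /= xw ?(negbTE xs) ?xs].
by move=> [] /word_gvertexP [_ [_ xw]]; apply/word_gvertexP.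
Qed.

(** The other child is empty, so both nodes carry the same projection. LP3 for a reversed tree edge
    rests on this. *)
Lemma word_proj_isolated b w : isolated G w -> valid G (b :: w) -> p (b :: w) = p w.
Proof.
move=> iw vbw; have hw := isolated_has iw; rewrite [RHS]word_proj_split //.
have nb : ~~ valid G (~~ b :: w).
  by apply/negP => vbw'; have := isolated_child_unique iw vbw vbw'; case: (b).
by case: b {vbw} nb => /= /word_projN ->; rewrite ?add0r ?addr0.
Qed.

Lemma word_proj_nv v : p (nv v) = P (gv1 v).
Proof.
congr P; apply: gvertex_inj; rewrite word_gvertexE ?wset_nv //.
by have /validP [] := valid_nv v.
Qed.

Lemma edge_word_proj e w : edge_word e w ->
  p w ** P (gvr e) = p w /\ P (gvr e) ** p w = p w.
Proof.
move=> /edge_wordP [sw [v ev vw]].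
suff sub : word_gvertex G w `<=` gvr e by split; [exact: fam_subl|exact: fam_subr].
move=> x /word_gvertexP [_ xw]; apply: (proj2 (@meas_ur _ e v x _ ev)).
by rewrite -sw vw xw.
Qed.

Lemma ghost_arrow e f : ss e ** s f = if e == f then P (gvr e) else 0.
Proof. by have [_ _ -> _] := lH. Qed.

Lemma vertex_arrow e : p (nv (us e)) ** s e = s e.
Proof. by rewrite word_proj_nv; have [_ /(_ e) [-> _ _ _] _ _] := lH. Qed.
Lemma ghost_vertex e : ss e ** p (nv (us e)) = ss e.
Proof. by rewrite word_proj_nv; have [_ /(_ e) [_ _ _ ->] _ _] := lH. Qed.

Lemma apex_proj w : p w ** p (apex w) = p w /\ p (apex w) ** p w = p w.
Proof.
case: (boolP (has id w)) => hw; last first.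
  by rewrite word_projN ?rmul0 ?rmulr0 //; apply: contra hw => /validP [].
suff sub : word_gvertex G w `<=` word_gvertex G (apex w).
  by split; [exact: fam_subl|exact: fam_subr].
move=> x /word_gvertexP [_ xw]; apply/word_gvertexP; split; last exact: bits_apex.
by have /andP [] := apex_is_apex hw.
Qed.

(** Distinct apexes have disjoint sets, and a word containing a true bit lies below just one of
    them. *)
Lemma is_apex_proj x w : is_apex x -> p x ** p w = if x == apex w then p w else 0.
Proof.
move=> rx; case: eqP => [->|xw]; first exact: (apex_proj w).2.
apply: fam_disj => v /word_gvertexP [_ vx] /word_gvertexP [hw vw]; apply: xw.
exact: is_apex_unique rx (apex_is_apex hw) vx (bits_apex vw).
Qed.

(** * A graph family from matrix units over the ultragraph algebra *)

Section MatrixUnits.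
Variables (A : rngAlgType R) (mu : seq bool -> seq bool -> S -> A).
Hypothesis muM : forall w x y z a b,
  mu w x a ** mu y z b = if x == y then mu w z (a ** b) else 0.
Hypothesis muD : forall w x, {morph mu w x : a b / a + b}.
Local Notation E := (tree_graph G).

Lemma mu0 w x : mu w x 0 = 0.
Proof. by apply: (addrI (mu w x 0)); rewrite -muD !addr0. Qed.

Lemma mu_sum (I : Type) (r : seq I) w x (F : I -> S) :
  mu w x (\sum_(i <- r) F i) = \sum_(i <- r) mu w x (F i).
Proof. by apply: big_morph; [exact: muD|exact: mu0]. Qed.

(** The matrix entry in row [sE f] and column [rE f]. A tree edge carries the projection of its
    lower end in either orientation. *)
Definition edge_weight (f : edge E) : S :=
  match f with inl t => p (val t) | inr l => s (val l).1 ** p (val l).2 end.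
Definition ghost_weight (f : edge E) : S :=
  match f with inl t => p (val t) | inr l => p (val l).2 ** ss (val l).1 end.

Definition graph_of_ultra (g : graph_gen E) : A :=
  match g with
  | GVertex x => mu (val x) (val x) (p (val x))
  | GEdge f => mu (val (sE f)) (val (rE f)) (edge_weight f)
  | GGhost f => mu (val (rE f)) (val (sE f)) (ghost_weight f)
  end.

Lemma tree_child_proj (t : {w : seq bool | valid G w && valid G (behead w)}) :
  p (behead (val t)) ** p (val t) = p (val t) /\ p (val t) ** p (behead (val t)) = p (val t).
Proof.
case: t => -[|b w] //= /andP [_ vw]; apply: word_proj_child.
by have /validP [] := vw.
Qed.

Lemma weight_vertices (f : edge E) :
  [/\ p (val (sE f)) ** edge_weight f = edge_weight f,
      edge_weight f ** p (val (rE f)) = edge_weight f,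
      p (val (rE f)) ** ghost_weight f = ghost_weight f &
      ghost_weight f ** p (val (sE f)) = ghost_weight f].
Proof.
case: f => [t|l] /=; last first.
  by rewrite rng_mulA vertex_arrow -!rng_mulA ghost_vertex word_projK rng_mulA word_projK.
have [e1 e2] := tree_child_proj t.
by case: ifP => _; rewrite /= ?e1 ?e2 ?word_projK.
Qed.

Lemma ghost_weight_edge (f : edge E) : ghost_weight f ** edge_weight f = p (val (rE f)).
Proof.
case: f => [t|l] /=; last first.
  rewrite -rng_mulA [ss _ ** _]rng_mulA ghost_arrow eqxx.
  have [_ e] := edge_word_proj (valP l); by rewrite e word_projK.
rewrite word_projK; case: ifP => // it /=.
case: t it => -[|b w] //= /andP [vbw _] iw; exact: word_proj_isolated.
Qed.

(** Two tree edges from one node have lower ends of equal length, hence with disjoint sets; two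
    links differ in the edge or in the piece; a tree edge and a link never share a source. *)
Lemma ghost_weight_orth (f g : edge E) : f != g -> sE f = sE g ->
  ghost_weight f ** edge_weight g = 0.
Proof.
move=> fg; case: f g fg => [t|l] [t'|l'] fg.
- move=> st /=; apply: word_proj_disj; last first.
    by apply: contra fg => /eqP tt'; apply/eqP; congr inl; exact: val_inj.
  move: st; rewrite /= /edge_source.
  case: ifP => it; case: ifP => it' /(congr1 val).
  + by move=> tt'; congr size.
  + by move=> tt'; have := isolated_behead it; rewrite (tt' : val t = behead (val t')) it'.
  + by move=> tt'; have := isolated_behead it'; rewrite -(tt' : behead (val t) = val t') it.
  + move=> tt'; have pos (u : {w : seq bool | valid G w && valid G (behead w)}) :
        size (val u) = (size (behead (val u))).+1 by case: u => -[].
    by rewrite !pos (tt' : behead (val t) = behead (val t')).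
- move=> st; exfalso; have : out (nvertex (us (val l').1)) (inl t) by exact: st.
  by move=> /out_nvP [].
- move=> /esym st; exfalso; have : out (nvertex (us (val l).1)) (inl t') by exact: st.
  by move=> /out_nvP [].
- move=> _ /=; rewrite -rng_mulA [ss _ ** _]rng_mulA ghost_arrow.
  case: eqP => [ll'|_]; last by rewrite rmul0 rmulr0.
  rewrite rng_mulA (edge_word_proj (valP l)).1; apply: word_proj_disj.
    have /edge_wordP [-> _] := valP l; have /edge_wordP [-> _] := valP l'.
    by rewrite ll'.
  apply: contra fg => /eqP ll2; apply/eqP; congr inr; apply: val_inj.
  by rewrite [val l]surjective_pairing ll' ll2 -surjective_pairing.
Qed.

Lemma graph_of_ultra_family : is_leavitt_family graph_of_ultra.
Proof.
have EG f : graph_of_ultra (GEdge f) ** graph_of_ultra (GGhost f) =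
    mu (val (sE f)) (val (sE f)) (edge_weight f ** ghost_weight f).
  by rewrite /= muM eqxx.
split=> /= [x y|f|f g|x fin ne].
- rewrite muM; case: eqP => [xy|xy].
    have -> : x = y by exact: val_inj.
    by rewrite eqxx word_projK.
  by case: eqP => // xy'; case: xy; rewrite xy'.
- by have [e1 e2 e3 e4] := weight_vertices f; rewrite !muM !eqxx e1 e2 e3 e4.
- rewrite muM; case: (eqVneq f g) => [<-|fg]; first by rewrite eqxx ghost_weight_edge.
  case: eqP => // /val_inj st; by rewrite ghost_weight_orth // mu0.
- have -> : \sum_(f \in [set e | edge_source e = x])
      mu (val (edge_source f)) (val (edge_range f)) (edge_weight f) **
      mu (val (edge_range f)) (val (edge_source f)) (ghost_weight f) =
    \sum_(f \in out x) mu (val x) (val x) (edge_weight f ** ghost_weight f).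
    by apply: eq_fsbigr => f /set_mem /= fx; rewrite muM eqxx fx.
  elim/tvertex_ind: x fin ne => [x ix|t it|v] fin ne.
  + rewrite out_open //.
    have hx : has id (val x) by have /validP [] := valP x.
    have tE c : at_tree (fun f => mu (val x) (val x) (edge_weight f ** ghost_weight f)) (c :: val x)
        = mu (val x) (val x) (p (c :: val x)).
      case: (boolP (valid G (c :: val x))) => [vc|nc].
        by have [z <- zw] := tree_wordP hx vc; rewrite at_treeT /= word_projK.
      by rewrite word_projN // mu0 at_treeN // (negbTE nc).
    by rewrite !tE -muD -word_proj_split.
  + by rewrite out_isolated //= word_projK.
  + have fin' : finite_set [set e : uedge G | us e = v] by exact/out_nv_finite.
    have ne' : [set e : uedge G | us e = v] !=set0 by exact/out_nv_neq0.
    rewrite out_nv // word_proj_nv; have [_ _ _ /(_ v fin' ne') /= ->] := lH.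
    rewrite !fsbig_finite //= mu_sum; apply: eq_bigr => e _.
    (* The projection of [ur e] is inserted between the arrow and its ghost and expanded into its
       pieces, one for each link. *)
    have -> : s e ** ss e = \sum_(w <- bitseqs (eidx e).+1)
        if edge_word e w then s e ** p w ** (p w ** ss e) else 0.
      have e1 : s e ** P (gvr e) = s e by have [_ /(_ e) []] := lH.
      rewrite -[in LHS]e1 fam_gvr rmul_sumr rmul_suml; apply: eq_bigr => w _.
      case: ifP => _; last by rewrite rmulr0 rmul0.
      by rewrite -!rng_mulA [p w ** (p w ** _)]rng_mulA word_projK.
    rewrite mu_sum; apply: eq_bigr => w _.
    case: ifP => ew; last by rewrite mu0 at_linkN // ew.
    pose l : {q : uedge G * seq bool | edge_word q.1 q.2} := exist _ (e, w) ew.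
    by rewrite (at_linkT _ l).
Qed.

End MatrixUnits.
End FromUltra.

(** * Local units *)

Lemma directed_left_local_units (S : rngType) (I : Type) (i0 : I) (u : I -> S)
    (join : I -> I -> I) :
  (forall i j, u (join i j) ** u i = u i /\ u (join i j) ** u j = u j) ->
  (forall a, exists i, u i ** a = a) -> left_local_units S.
Proof.
move=> ujoin ua s; suff [i iP] : exists i, forall x, x \in s -> u i ** x = x by exists (u i).
elim: s => [|a s [i IHi]]; first by exists i0.
have [j ja] := ua a; exists (join i j) => x; rewrite inE => /orP [/eqP ->|xs].
  by rewrite -{1}ja rng_mulA (ujoin i j).2 ja.
by rewrite -{1}(IHi x xs) rng_mulA (ujoin i j).1 IHi.
Qed.

(** Elements fixed by some [u i] contain the generators and are closed under the operations: sums
    use [join], products the unit of the left factor. *)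
Lemma univ_unit_ind (R : comPzRingType) (X : Type)
    (P : forall A : rngAlgType R, (X -> A) -> Prop) (I : Type) (i0 : I)
    (u : I -> univ_alg P) (join : I -> I -> I) :
  (forall i j, u (join i j) ** u i = u i /\ u (join i j) ** u j = u j) ->
  (forall x, exists i, u i ** univ_gen P x = univ_gen P x) ->
  forall a, exists i, u i ** a = a.
Proof.
move=> ujoin ugen; apply: univ_ind => [//||a b [i ia] [j jb]|c a [i ia]|a b [i ia] _].
- by exists i0; rewrite rmulr0.
- exists (join i j); rewrite rng_mulDr -{1}ia -{1}jb !rng_mulA.
  by rewrite (ujoin i j).1 (ujoin i j).2 ia jb.
- by exists i; rewrite -rng_scaleAr ia.
- by exists i; rewrite rng_mulA ia.
Qed.

(** * Matrices acting on word-indexed families *)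

Section MatrixModule.
Variables (R : comPzRingType) (S : rngAlgType R) (M : linModType S).

Definition matrix_unit_fun (w x : seq bool) (a : S) (f : seq bool -> M) : seq bool -> M :=
  fun z => if z == w then a *> f x else 0.

Fact matrix_unit_linear w x a : linear (matrix_unit_fun w x a).
Proof.
move=> c f g; apply: funext => z.
have linE (h k : seq bool -> M) y : (c *: h + k) y = c *: h y + k y by [].
rewrite linE /matrix_unit_fun; case: (z == w); last by rewrite scaler0 addr0.
by rewrite linE rng_actDr act_scaler.
Qed.

Definition matrix_unit w x a : endo (seq bool -> M) := mk_endo (matrix_unit_linear w x a).

Lemma matrix_unitE w x a (f : seq bool -> M) z :
  matrix_unit w x a f z = if z == w then a *> f x else 0.
Proof. by []. Qed.

Lemma matrix_unitM w x y z (a b : S) :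
  matrix_unit w x a ** matrix_unit y z b = if x == y then matrix_unit w z (a ** b) else 0.
Proof.
apply: endo_ext => f; apply: funext => v; rewrite endo_mulE !matrix_unitE.
case: (x == y); rewrite ?matrix_unitE; case: (v == w) => //; first by rewrite rng_actA.
by rewrite act0r.
Qed.

Lemma matrix_unitD w x : {morph matrix_unit w x : a b / a + b}.
Proof.
move=> a b; apply: endo_ext => f; apply: funext => v.
have DE (h k : seq bool -> M) y : (h + k) y = h y + k y by [].
rewrite endo_addE DE !matrix_unitE.
by case: (v == w); rewrite ?rng_actDl ?addr0.
Qed.

Variables (G : ultragraph) (H : ultragraph_gen G -> S) (lH : is_ultra_leavitt_family H).

Definition matrix_module : linModType (leavitt_path_algebra R (tree_graph G)) :=
  rep_module (graph_of_ultra_family lH matrix_unitM matrix_unitD).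

End MatrixModule.

(** * The two functors and the equivalence *)

Section MoritaEquivalence.
Variables (R : comPzRingType) (G : ultragraph).
Local Notation E := (tree_graph G).
Local Notation LG := (ultra_leavitt_path_algebra R G).
Local Notation LE := (leavitt_path_algebra R E).
Local Notation genG := (univ_gen (@is_ultra_leavitt_family R G)).
Local Notation genE := (univ_gen (@is_leavitt_family R E)).

Let lG : is_ultra_leavitt_family genG := ultra_leavitt_path_algebra_family R G.
Let lE : is_leavitt_family genE := leavitt_path_algebra_family R E.

Local Notation P B := (genG (UVertex B)).
Local Notation p := (word_proj genG).
Local Notation s e := (genG (UEdge e)).
Local Notation ss e := (genG (UGhost e)).
Local Notation q := (vproj genE).
Local Notation J := (path_to genE).
Local Notation Js := (path_from genE).

Let proj_level B n : meas (gvset B) n -> P B = \sum_(w <- bitseqs n | hits (gvset B) w) p w.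
Proof. exact: (fam_level lG (B := B)). Qed.
Let range_proj e : P (gvr e) = \sum_(w <- bitseqs (eidx e).+1) if edge_word e w then p w else 0.
Proof. exact: (fam_gvr lG e). Qed.
Let source_arrow e : p (nv (us e)) ** s e = s e.
Proof. exact: (vertex_arrow lG e). Qed.
Let ghost_source e : ss e ** p (nv (us e)) = ss e.
Proof. exact: (ghost_vertex lG e). Qed.
Let arrow_range e : s e ** P (gvr e) = s e.
Proof. by have [_ /(_ e) [_ + _ _] _ _] := lG. Qed.
Let range_ghost e : P (gvr e) ** ss e = ss e.
Proof. by have [_ /(_ e) [_ _ + _] _ _] := lG. Qed.

Lemma gvU_unit (B C : gvertex G) :
  P (gvU B C) ** P B = P B /\ P (gvU B C) ** P C = P C.
Proof.
by split; [apply: (fam_subr lG (B := B)) => x; left|apply: (fam_subr lG (B := C)) => x; right].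
Qed.

Lemma LG_unit (a : LG) : exists B, P B ** a = a.
Proof.
move: a; apply: (univ_unit_ind gv0 gvU_unit) => -[B|e|e].
- by exists B; exact: (fam_subr lG (B := B)).
- by exists (gv1 (us e)); have [_ /(_ e) [+ _ _ _] _ _] := lG.
- by exists (gvr e); have [_ /(_ e) [_ _ + _] _ _] := lG.
Qed.

Lemma LG_local_units : left_local_units LG.
Proof. exact: (directed_left_local_units gv0 gvU_unit LG_unit). Qed.

(** Removing duplicates keeps this sum of orthogonal projections idempotent; invalid words
    contribute 0. *)
Definition words_unit (ws : seq (seq bool)) : LE := \sum_(w <- undup ws) q w.

Lemma words_unit_vproj ws w : w \in ws -> words_unit ws ** q w = q w.
Proof.
move=> wws; rewrite /words_unit rmul_suml (bigD1_seq w) ?undup_uniq ?mem_undup //=.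
rewrite (vprojM lE) eqxx big1 ?addr0 // => w' /negbTE ww'.
by rewrite (vprojM lE) ww'.
Qed.

Lemma words_unit_cat (ws ws' : seq (seq bool)) :
  words_unit (ws ++ ws') ** words_unit ws = words_unit ws /\
  words_unit (ws ++ ws') ** words_unit ws' = words_unit ws'.
Proof.
split; rewrite {2}/words_unit rmul_sumr; apply: eq_big_seq => w; rewrite mem_undup => ww;
  by rewrite words_unit_vproj // mem_cat ww ?orbT.
Qed.

Lemma LE_unit (a : LE) : exists ws, words_unit ws ** a = a.
Proof.
move: a; apply: (univ_unit_ind [::] words_unit_cat) => g.
suff [w qg] : exists w, q w ** genE g = genE g.
  by exists [:: w]; rewrite /words_unit /= big_seq1.
have qE (x : vertex E) : q (val x) = genE (GVertex x) by rewrite /vproj at_vertexT.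
case: g => [x|f|f].
- by exists (val x); rewrite qE (LP1 lE) eqxx.
- by exists (val (sE f)); rewrite qE; have [] := LP2 lE f.
- by exists (val (rE f)); rewrite qE; have [] := LP2 lE f.
Qed.

Lemma LE_local_units : left_local_units LE.
Proof. exact: (directed_left_local_units [::] words_unit_cat LE_unit). Qed.

Lemma MOD_unit (S : rngType) (M : MOD_obj S) (m : M) :
  left_local_units S -> exists a : S, a *> m = m.
Proof.
move=> luS; have [r ->] := MOD_unital m; have [e eP] := luS [seq x.1 | x <- r].
exists e; rewrite act_sumr; apply: eq_big_seq => x xr.
by rewrite -rng_actA eP // map_f.
Qed.

Lemma MOD_LG_unit (M : MOD_obj LG) (m : M) : exists B, P B *> m = m.
Proof.
have [a am] := MOD_unit m LG_local_units; have [B Ba] := LG_unit a.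
by exists B; rewrite -am -rng_actA Ba.
Qed.

Lemma MOD_LE_unit (N : MOD_obj LE) (n : N) : exists ws, words_unit ws *> n = n.
Proof.
have [a an] := MOD_unit n LE_local_units; have [ws wa] := LE_unit a.
by exists ws; rewrite -an -rng_actA wa.
Qed.

(** * How paths and the ultragraph family act on the matrix module *)

Section MatrixAction.
Variable M : linModType LG.
Local Notation W := (matrix_module M lG).
Local Notation mu := (@matrix_unit R LG M).

Lemma matrix_unit0 w x (f : W) : mu w x 0 f = 0 :> W.
Proof.
have -> : mu w x 0 = 0 by apply: (mu0 (@matrix_unitD R LG M)).
by [].
Qed.

Lemma act_gen g (f : W) : genE g *> f = graph_of_ultra genG mu g f :> W.
Proof. exact: rep_act_gen. Qed.

Lemma matrix_unit_act w x y z (a b : LG) (f : W) :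
  mu w x a (mu y z b f) = if x == y then mu w z (a ** b) f else 0 :> W.
Proof.
have := congr1 (fun g : endo (seq bool -> M) => g f) (matrix_unitM M w x y z a b).
by rewrite endo_mulE => ->; case: (x == y).
Qed.

Lemma act_vproj w (f : W) : q w *> f = mu w w (p w) f :> W.
Proof.
case: (boolP (valid G w)) => vw; first by rewrite (vprojE _ vw) act_gen.
by rewrite vprojN // (word_projN lG) // matrix_unit0 act0l.
Qed.

Lemma act_descend b w (f : W) : has id w -> descend genE (b :: w) *> f = mu w (b :: w) (p (b :: w)) f :> W.
Proof.
move=> hw; case: (boolP (valid G (b :: w))) => vbw; last first.
  by rewrite descendN // (word_projN lG) // matrix_unit0 act0l.
have [x xb xw] := tree_wordP hw vbw; rewrite -xb -{1}xw descendE.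
by case: ifP => ix; rewrite act_gen /= ix.
Qed.

Lemma act_ascend b w (f : W) : has id w ->
  ascend genE (b :: w) *> f = mu (b :: w) w (p (b :: w)) f :> W.
Proof.
move=> hw; case: (boolP (valid G (b :: w))) => vbw; last first.
  by rewrite ascendN // (word_projN lG) // matrix_unit0 act0l.
have [x xb xw] := tree_wordP hw vbw; rewrite -xb -{1}xw ascendE.
by case: ifP => ix; rewrite act_gen /= ix.
Qed.

(** The projections decrease along the path, so the product of matrix units collapses to one whose
    entry is the smallest, [p w]. *)
Lemma act_path_to w (f : W) : J w *> f = mu (apex w) w (p w) f :> W.
Proof.
elim: w f => [|b w IHw] f; first by rewrite act0l (word_projN lG) // matrix_unit0.
rewrite [J _]/= [apex _]/=.
case: ifP => hw; last exact: act_vproj.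
by rewrite rng_actA act_descend // IHw matrix_unit_act eqxx (word_proj_child lG b hw).1.
Qed.

Lemma act_path_from w (f : W) : Js w *> f = mu w (apex w) (p w) f :> W.
Proof.
elim: w f => [|b w IHw] f; first by rewrite act0l (word_projN lG) // matrix_unit0.
rewrite [Js _]/= [apex _]/=.
case: ifP => hw; last exact: act_vproj.
by rewrite rng_actA IHw act_ascend // matrix_unit_act eqxx (word_proj_child lG b hw).2.
Qed.

Lemma act_wproj w (f : W) : wproj genE w *> f = mu (apex w) (apex w) (p w) f :> W.
Proof. by rewrite /wproj rng_actA act_path_from act_path_to matrix_unit_act eqxx word_projK. Qed.

Lemma act_gproj B n (f : W) : meas (gvset B) n ->
  gproj genE B *> f = \sum_(w <- bitseqs n | hits (gvset B) w) mu (apex w) (apex w) (p w) f :> W.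
Proof.
by move=> mB; rewrite (gprojE lE mB) act_suml; apply: eq_bigr => w _; exact: act_wproj.
Qed.

Lemma act_uarrow e (f : W) : uarrow genE e *> f = \sum_(w <- bitseqs (eidx e).+1)
  (if edge_word e w then mu (apex (nv (us e))) (apex w) (s e ** p w) f else 0) :> W.
Proof.
rewrite act_suml; apply: eq_bigr => w _; rewrite !rng_actA.
case: ifP => ew; last by rewrite at_linkN ?ew // act0l act0r.
rewrite act_path_from act_path_to.
pose l : {q : uedge G * seq bool | edge_word q.1 q.2} := exist _ (e, w) ew.
have -> : at_link (genE \o @GEdge E) e w = genE (GEdge (inr l : edge E)) by exact: (at_linkT _ l).
rewrite act_gen -[graph_of_ultra _ _ _]/(mu (nv (us e)) w (genG (UEdge e) ** p w)).
rewrite !matrix_unit_act !eqxx !rng_mulA source_arrow -rng_mulA.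
by rewrite (word_projK lG).
Qed.

Lemma act_ughost e (f : W) : ughost genE e *> f = \sum_(w <- bitseqs (eidx e).+1)
  (if edge_word e w then mu (apex w) (apex (nv (us e))) (p w ** ss e) f else 0) :> W.
Proof.
rewrite act_suml; apply: eq_bigr => w _; rewrite !rng_actA.
case: ifP => ew; last by rewrite at_linkN ?ew // act0l act0r.
rewrite act_path_from act_path_to.
pose l : {q : uedge G * seq bool | edge_word q.1 q.2} := exist _ (e, w) ew.
have -> : at_link (genE \o @GGhost E) e w = genE (GGhost (inr l : edge E)) by exact: (at_linkT _ l).
rewrite act_gen -[graph_of_ultra _ _ _]/(mu w (nv (us e)) (p w ** genG (UGhost e))).
rewrite !matrix_unit_act !eqxx !rng_mulA (word_projK lG) -rng_mulA.
by rewrite ghost_source.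
Qed.

Lemma matrix_sumE (I : Type) (r : seq I) (Q : pred I) (F : I -> W) z :
  (\sum_(i <- r | Q i) F i : W) z = \sum_(i <- r | Q i) F i z.
Proof. by apply: (big_morph (fun h : W => h z)). Qed.

End MatrixAction.

Definition phi : LG -> LE := univ_eval (ultra_of_graph genE).

Fact phi_hom : alg_hom phi.
Proof. exact: univ_eval_hom (ultra_of_graph_family lE). Qed.

Lemma phi_gen g : phi (genG g) = ultra_of_graph genE g.
Proof. exact: univ_eval_gen (ultra_of_graph_family lE) g. Qed.

(** * Comparison for modules over the ultragraph algebra *)

Section Theta.
Variable M : linModType LG.
Local Notation W := (matrix_module M lG).

(** The image of [LG] under [phi] acts through matrix units indexed by apexes, hence the restriction
    to these components. *)
Definition theta_fun (m : M) : W := fun w => if is_apex w then p w *> m else 0.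

Lemma theta_funE m w : theta_fun m w = if is_apex w then p w *> m else 0.
Proof. by []. Qed.

Fact theta_linear : linear (theta_fun : M -> W).
Proof.
move=> c m n; apply: funext => w.
have -> : (c *: theta_fun m + theta_fun n) w = c *: theta_fun m w + theta_fun n w by [].
rewrite /theta_fun; case: (is_apex w); last by rewrite scaler0 addr0.
by rewrite rng_actDr act_scaler.
Qed.

Lemma theta_apex w m : p w *> theta_fun m (apex w) = p w *> m.
Proof.
case: (boolP (has id w)) => hw; last first.
  by rewrite (word_projN lG) ?act0l //; apply: contra hw => /validP [].
by rewrite /theta_fun apex_is_apex // -rng_actA (apex_proj lG w).1.
Qed.

Lemma apex_proj_act z w (m : M) :
  (if is_apex z then p z *> (p w *> m) else 0) = if z == apex w then p w *> m else 0.
Proof.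
case: ifP => az; first by rewrite -rng_actA (is_apex_proj lG) //; case: eqP; rewrite ?act0l.
case: eqP => // zw; rewrite (word_projN lG) ?act0l //.
by apply/negP => /validP [hw _]; rewrite zw apex_is_apex in az.
Qed.

(** After each generator is split into pieces [p w], a piece is visible at one apex only, and both
    sides agree term by term. *)
Lemma theta_gen g m : theta_fun (genG g *> m) = ultra_of_graph genE g *> theta_fun m.
Proof.
case: g => [B|e|e] /=; apply: funext => z.
- rewrite (act_gproj _ (@glevelP _ B)) matrix_sumE [LHS]theta_funE.
  rewrite (proj_level (@glevelP _ B)) act_suml act_sumr.
  transitivity (\sum_(w <- bitseqs (glevel B) | hits B w)
      if is_apex z then p z *> (p w *> m) else 0).
    by case: ifP => // _; rewrite big1.
  apply: eq_bigr => w _; rewrite apex_proj_act matrix_unitE.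
  by case: eqP => // _; rewrite theta_apex.
- rewrite act_uarrow matrix_sumE [LHS]theta_funE.
  rewrite -{1}source_arrow rng_actA apex_proj_act.
  transitivity (if z == apex (nv (us e)) then
      \sum_(w <- bitseqs (eidx e).+1) (if edge_word e w then s e ** p w else 0) *> m else 0).
    case: eqP => // _; rewrite -rng_actA source_arrow -act_suml.
    rewrite -{1}arrow_range.
    rewrite range_proj rmul_sumr; congr (_ *> m); apply: eq_bigr => w _.
    by case: ifP; rewrite ?rmulr0.
  case: eqP => zn; last first.
    rewrite big1 // => w _; case: ifP => // _; rewrite matrix_unitE.
    by case: eqP.
  apply: eq_bigr => w _; case: ifP => ew; last by rewrite act0l.
  by rewrite matrix_unitE zn eqxx !rng_actA theta_apex.
- rewrite act_ughost matrix_sumE [LHS]theta_funE.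
  rewrite -{1}range_ghost.
  rewrite range_proj rmul_suml act_suml act_sumr.
  transitivity (\sum_(w <- bitseqs (eidx e).+1) if edge_word e w then
      (if is_apex z then p z *> (p w *> (ss e *> m)) else 0) else 0).
    case: ifP => _; last by rewrite big1 // => w _; case: ifP.
    apply: eq_bigr => w _; case: ifP => _; first by congr (_ *> _); exact: rng_actA.
    by rewrite rmul0 act0l act0r.
  apply: eq_bigr => w _; case: ifP => // _; rewrite apex_proj_act matrix_unitE.
  case: eqP => // _; rewrite -ghost_source !rng_actA.
  by rewrite theta_apex.
Qed.

Lemma theta_act a m : theta_fun (a *> m) = phi a *> theta_fun m.
Proof.
have key g n : theta_fun (genG g *> n) = genG g *> (theta_fun n : pullback W phi_hom) :>
    pullback W phi_hom.
  by rewrite pull_actE phi_gen; exact: theta_gen.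
exact: (@intertwiner R _ _ M (pullback W phi_hom) theta_fun theta_linear key a m).
Qed.

(** Some [P B] fixes [m], so [m] is the sum of finitely many [p w *> m], each readable from the
    component at the apex of [w]. *)
Lemma theta_inj : (forall m : M, exists B, P B *> m = m) ->
  forall m, theta_fun m = 0 -> m = 0.
Proof.
move=> Munit m tm; have [B <-] := Munit m.
rewrite (proj_level (@glevelP _ B)) act_suml big1 // => w _.
by rewrite -theta_apex tm act0r.
Qed.

Lemma theta_surj B (f : W) : phi (P B) *> f = f -> exists m, theta_fun m = f.
Proof.
(* The components are cut to the pieces of [B] and reassembled; nothing is lost because [phi (P B)]
   fixes [f]. *)
move=> Bf; exists (\sum_(w <- bitseqs (glevel B) | hits B w) p w *> f (apex w)).
rewrite -[RHS]Bf phi_gen (act_gproj _ (@glevelP _ B)); apply: funext => z.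
rewrite matrix_sumE [LHS]theta_funE act_sumr.
transitivity (\sum_(w <- bitseqs (glevel B) | hits B w)
    if is_apex z then p z *> (p w *> f (apex w)) else 0).
  by case: ifP => // _; rewrite big1.
by apply: eq_bigr => w _; rewrite apex_proj_act matrix_unitE.
Qed.

End Theta.

Definition restrict_obj (N : MOD_obj LE) : MOD_obj LG :=
  upartMOD (pullback (linearized N) phi_hom) LG_local_units.

Definition extend_obj (M : MOD_obj LG) : MOD_obj LE :=
  upartMOD (matrix_module (linearized M) lG) LE_local_units.

(** * Comparison for modules over the graph algebra *)

Section Zeta.
Variable N : MOD_obj LE.
Local Notation W := (matrix_module (linearized (restrict_obj N)) lG).

Lemma phi_word w : phi (p w) = wproj genE w.
Proof. by rewrite phi_gen; exact: gproj_word_gvertex. Qed.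

Fact path_act_upart w (n : N) :
  J w *> n \in @upart_pred R LG (pullback (linearized N) phi_hom).
Proof.
have -> : J w *> n = p w *> (J w *> n : pullback (linearized N) phi_hom).
  by rewrite pull_actE phi_word; apply: etrans (rng_actA _ _ _); rewrite wproj_path.
exact: act_upart.
Qed.

Definition zeta_fun (n : N) : W :=
  fun w => mk_upart LG_local_units (path_act_upart w n) : restrict_obj N.

Lemma zetaE n w : upart_val (zeta_fun n w) = J w *> n.
Proof. by []. Qed.

Fact zeta_linear : linear (zeta_fun : linearized N -> W).
Proof.
move=> c m n; apply: funext => w.
have -> : (c *: zeta_fun m + zeta_fun n) w = c *: zeta_fun m w + zeta_fun n w by [].
rewrite [c *: zeta_fun m w]linearized_upart_scaleE; apply: val_inj => /=.
by rewrite rng_actDr; congr (_ + _); exact: act_scaler.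
Qed.

Lemma matrix_unit_zeta w x (a : LG) n z :
  upart_val (matrix_unit (linearized (restrict_obj N)) w x a (zeta_fun n) z) = if z == w then (phi a ** J x) *> n else 0.
Proof. by rewrite matrix_unitE; case: eqP => // _; rewrite rng_actA. Qed.

(** Every generator acts as a single matrix unit with an entry [a] independent of the module, and
    pushing a path through it produces the same entry, transported by [phi]. *)
Lemma path_gen z g : exists w x a,
  (forall M : linModType LG, graph_of_ultra genG (@matrix_unit R LG M) g = matrix_unit M w x a) /\
  J z ** genE g = if z == w then phi a ** J x else 0.
Proof.
have mphi a b : phi (a ** b) = phi a ** phi b := phi_hom.2 a b.
have tw (t : {w : seq bool | valid G w && valid G (behead w)}) :
    exists b w, [/\ val t = b :: w, behead (val t) = w & has id w].
  move: (tree_edge_valid_behead t); case: (val t) => [//|b w /validP [hw _]].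
  by exists b, w.
case: g => [x|[t|l]|[t|l]].
- exists (val x), (val x), (p (val x)); split=> //.
  have -> : genE (GVertex x) = q (val x) by rewrite /vproj at_vertexT.
  by rewrite path_to_vprojM // phi_word; case: eqP => // ->; rewrite wproj_path.
- exists (val (edge_source (inl t))), (val (edge_range (inl t))), (p (val t)); split=> //.
  have [b [w [tE bE hw]]] := tw t; rewrite phi_word.
  have -> : genE (GEdge (inl t : edge E)) = _ := (tree_edgeE genE t).1.
  rewrite /edge_source /edge_range; case: ifP => _ /=.
    by rewrite -[sval t]/(val t) bE tE path_ascend.
  rewrite -[sval t]/(val t) bE tE path_descend //.
  by case: eqP => // _; rewrite wproj_path.
- exists (nv (us (val l).1)), (val l).2, (s (val l).1 ** p (val l).2); split=> //.
  have -> : genE (GEdge (inr l : edge E)) = at_link (genE \o @GEdge E) (val l).1 (val l).2.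
    by rewrite at_linkT.
  rewrite path_link //; last exact: (valP l).
  by rewrite mphi phi_word phi_gen /= -rng_mulA wproj_path.
- exists (val (edge_range (inl t))), (val (edge_source (inl t))), (p (val t)); split=> //.
  have [b [w [tE bE hw]]] := tw t; rewrite phi_word.
  have -> : genE (GGhost (inl t : edge E)) = _ := (tree_edgeE genE t).2.
  rewrite /edge_source /edge_range; case: ifP => _ /=.
    rewrite -[sval t]/(val t) bE tE path_descend //.
    by case: eqP => // _; rewrite wproj_path.
  by rewrite -[sval t]/(val t) bE tE path_ascend.
- exists (val l).2, (nv (us (val l).1)), (p (val l).2 ** ss (val l).1); split=> //.
  have -> : genE (GGhost (inr l : edge E)) = at_link (genE \o @GGhost E) (val l).1 (val l).2.
    by rewrite at_linkT.
  rewrite path_ghost //; last exact: (valP l).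
  by rewrite mphi phi_word phi_gen.
Qed.

Lemma zeta_gen g n : zeta_fun (genE g *> n) = genE g *> zeta_fun n.
Proof.
rewrite act_gen; apply: funext => z; have [w [x [a [-> ga]]]] := path_gen z g.
apply: val_inj; rewrite [RHS]matrix_unit_zeta [LHS]zetaE -rng_actA ga.
by case: eqP => // _; rewrite act0l.
Qed.

Lemma zeta_act a n : zeta_fun (a *> n) = a *> zeta_fun n.
Proof. exact: (@intertwiner R _ _ (linearized N) W zeta_fun zeta_linear zeta_gen a n). Qed.

(** The vertex projection [q w] factors as [Js w ** J w], so vanishing of all [J w *> n] kills every
    [q w *> n]. *)
Lemma zeta_inj n : zeta_fun n = 0 -> n = 0.
Proof.
move=> zn; have [ws <-] := MOD_LE_unit n; rewrite act_suml big1 // => w _.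
have -> : q w = Js w ** J w by rewrite path_from_to // eqxx.
by rewrite rng_actA -zetaE zn act0r.
Qed.

Lemma zeta_surj ws (f : W) : words_unit ws *> f = f -> exists n, zeta_fun n = f.
Proof.
(* [Js w] inverts [J w] on the component at [w], and only words in [ws] carry components. *)
move=> wf; exists (\sum_(w <- undup ws) Js w *> (upart_val (f w) : N)).
rewrite -[RHS]wf act_suml; apply: funext => z; rewrite matrix_sumE.
transitivity (\sum_(w <- undup ws) if z == w then p w *> f w else 0); last first.
  by apply: eq_bigr => w _; rewrite act_vproj matrix_unitE.
apply: val_inj; rewrite [LHS]zetaE act_sumr.
have val_sum (r : seq (seq bool)) (F : seq bool -> restrict_obj N) :
    upart_val (\sum_(w <- r) F w) = \sum_(w <- r) (upart_val (F w) : N).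
  exact: (big_morph (fun y : restrict_obj N => upart_val y : N)).
apply: etrans (esym (val_sum _ _)).
apply: eq_bigr => w _; case: eqP => [->|/eqP zw].
  by rewrite -rng_actA -/(wproj genE w) -phi_word.
by rewrite -rng_actA path_to_from // act0l.
Qed.

End Zeta.

(** * Action of the functors on homomorphisms *)

Section ExtendMap.
Variables (M N : MOD_obj LG) (h : module_hom M N).
Local Notation WM := (matrix_module (linearized M) lG).
Local Notation WN := (matrix_module (linearized N) lG).

Definition extend_fun (f : WM) : WN := fun w => h (f w).

Fact extend_linear : linear extend_fun.
Proof. by move=> c f g; apply: funext => w; exact: (module_hom_linear h c (f w) (g w)). Qed.

Fact extendD : {morph extend_fun : f g / f + g}.
Proof. by move=> f g; apply: funext => w; exact: (module_homD h). Qed.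

Fact extend_gen g (f : WM) : extend_fun (genE g *> f) = genE g *> extend_fun f.
Proof.
(* The dummy word [[::]] gives access to the matrix form of [g], with the same entry [a] over [M]
   and over [N]. *)
rewrite !act_gen; have [w [x [a [e _]]]] := path_gen [::] g; rewrite !e.
apply: funext => z; rewrite [RHS]matrix_unitE /extend_fun matrix_unitE.
by case: (z == w); [exact: (module_homZ h a (f x))|exact: (module_hom0 h)].
Qed.

Fact extend_act a (f : WM) : extend_fun (a *> f) = a *> extend_fun f.
Proof. exact: (@intertwiner R _ _ WM WN extend_fun extend_linear extend_gen a f). Qed.

Definition extend_hom : module_hom (extend_obj M) (extend_obj N) :=
  upart_hom LE_local_units extendD extend_act.
End ExtendMap.

Definition extend_functor : functor (MOD LG) (MOD LE).
Proof.
apply: (@Functor (MOD LG) (MOD LE) extend_obj extend_hom) => [M|M N K g f];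
  by apply: module_hom_ext => x; apply: val_inj.
Defined.

Section RestrictMap.
Variables (M N : MOD_obj LE) (h : module_hom M N).
Local Notation VM := (pullback (linearized M) phi_hom).
Local Notation VN := (pullback (linearized N) phi_hom).

Definition restrict_fun (m : VM) : VN := h m.
Fact restrictD : {morph restrict_fun : x y / x + y}.
Proof. exact: (module_homD h). Qed.
Fact restrict_act (a : LG) (m : VM) : restrict_fun (a *> m) = a *> restrict_fun m.
Proof. exact: (module_homZ h (phi a) m). Qed.

Definition restrict_hom : module_hom (restrict_obj M) (restrict_obj N) :=
  upart_hom LG_local_units restrictD restrict_act.
End RestrictMap.

Definition restrict_functor : functor (MOD LE) (MOD LG).
Proof.
apply: (@Functor (MOD LE) (MOD LG) restrict_obj restrict_hom) => [M|M N K g f];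
  by apply: module_hom_ext => x; apply: val_inj.
Defined.

Section Unit.
Variable M : MOD_obj LG.

(** Some [P B] fixes [m], hence [phi (P B)] fixes its image. The same unit serves again below for
    the unital part over [LG]. *)
Fact theta_upart (m : M) :
  theta_fun (m : linearized M) \in @upart_pred R LE (matrix_module (linearized M) lG).
Proof.
have [B <-] := MOD_LG_unit m.
rewrite (theta_act (M := linearized M)); exact: act_upart.
Qed.

Definition theta_extend (m : M) : extend_obj M := mk_upart LE_local_units (theta_upart m).

Fact theta_extend_act (a : LG) m : theta_extend (a *> m) = phi a *> theta_extend m.
Proof. by apply: val_inj; exact: (theta_act (M := linearized M)). Qed.

Fact theta_extend_upart (m : M) :
  theta_extend m \in @upart_pred R LG (pullback (linearized (extend_obj M)) phi_hom).
Proof.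
have [B <-] := MOD_LG_unit m; rewrite theta_extend_act.
exact: (@act_upart R LG (pullback (linearized (extend_obj M)) phi_hom) (P B) (theta_extend m)).
Qed.

Definition theta (m : M) : restrict_obj (extend_obj M) :=
  mk_upart LG_local_units (theta_extend_upart m).

Fact thetaD : {morph theta : m n / m + n}.
Proof.
move=> m n; apply: val_inj; apply: val_inj => /=.
by have := @theta_linear (linearized M) 1 m n; rewrite !scale1r.
Qed.
Fact thetaZ (a : LG) m : theta (a *> m) = a *> theta m.
Proof. by apply: val_inj; exact: theta_extend_act. Qed.

Definition theta_hom : module_hom M (restrict_obj (extend_obj M)) := ModuleHom thetaD thetaZ.

Lemma theta_hom_inj : injective theta_hom.
Proof.
move=> m n mn; apply/eqP; rewrite -subr_eq0; apply/eqP.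
apply: (theta_inj (M := linearized M)); first exact: MOD_LG_unit.
have := congr1 (fun x : restrict_obj (extend_obj M) => upart_val (upart_val x : extend_obj M)) mn.
move=> /= e; suff : theta_fun (-1 *: (n : linearized M) + m) = 0 by rewrite scaleN1r addrC.
by rewrite (theta_linear (M := linearized M)) scaleN1r e addNr.
Qed.

Lemma theta_hom_surj x : exists m, theta_hom m = x.
Proof.
have [B Bx] := MOD_LG_unit x.
have [m mx] := @theta_surj (linearized M) B (upart_val (upart_val x : extend_obj M))
  (congr1 (fun y : restrict_obj (extend_obj M) => upart_val (upart_val y : extend_obj M)) Bx).
by exists m; apply: val_inj; apply: val_inj.
Qed.

End Unit.

Section Counit.
Variable N : MOD_obj LE.

Fact zeta_upart (n : N) :
  zeta_fun n \in @upart_pred R LE (matrix_module (linearized (restrict_obj N)) lG).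
Proof. by have [ws <-] := MOD_LE_unit n; rewrite zeta_act; exact: act_upart. Qed.

Definition zeta (n : N) : extend_obj (restrict_obj N) := mk_upart LE_local_units (zeta_upart n).

Fact zetaD : {morph zeta : m n / m + n}.
Proof.
move=> m n; apply: val_inj => /=.
by have := @zeta_linear N 1 m n; rewrite !scale1r.
Qed.
Fact zetaZ (a : LE) n : zeta (a *> n) = a *> zeta n.
Proof. by apply: val_inj; exact: zeta_act. Qed.

Definition zeta_hom : module_hom N (extend_obj (restrict_obj N)) := ModuleHom zetaD zetaZ.

Lemma zeta_hom_inj : injective zeta_hom.
Proof.
move=> m n mn; apply/eqP; rewrite -subr_eq0; apply/eqP; apply: zeta_inj.
have := congr1 (fun x : extend_obj (restrict_obj N) => upart_val x) mn.
move=> /= e; suff : zeta_fun (-1 *: (n : linearized N) + m) = 0 by rewrite scaleN1r addrC.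
by rewrite zeta_linear scaleN1r e addNr.
Qed.

Lemma zeta_hom_surj x : exists n, zeta_hom n = x.
Proof.
have [ws wx] := MOD_LE_unit x.
have [n nx] := @zeta_surj N ws (upart_val x)
  (congr1 (fun y : extend_obj (restrict_obj N) => upart_val y) wx).
by exists n; apply: val_inj.
Qed.

End Counit.

(** Naturality of the two comparison maps says that homomorphisms commute with the actions of [p w]
    and [J w]. *)
Lemma morita_tree_graph : morita_equivalent LG LE.
Proof.
exists extend_functor, restrict_functor; split.
- apply: (@nat_iso_of_bijective LG (functor_comp restrict_functor extend_functor) theta_hom) => [M|M|M N f x].
  + exact: theta_hom_inj.
  + exact: theta_hom_surj.
  + apply: val_inj; apply: val_inj; apply: funext => w.
    rewrite /= /extend_fun /= /theta_fun; case: ifP => _; last by rewrite module_hom0.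
    exact: (esym (module_homZ (f : module_hom M N) (p w) x)).
- apply: (@nat_iso_of_bijective LE (functor_comp extend_functor restrict_functor) zeta_hom) => [N|N|M N f x].
  + exact: zeta_hom_inj.
  + exact: zeta_hom_surj.
  + apply: val_inj; apply: funext => w; apply: val_inj.
    exact: (esym (module_homZ (f : module_hom M N) (J w) x)).
Qed.

End MoritaEquivalence.

Theorem theorem10p6 (G : ultragraph) (R : comPzRingType) :
  exists E : graph,
    morita_equivalent (ultra_leavitt_path_algebra R G) (leavitt_path_algebra R E).
Proof. by exists (tree_graph G); exact: morita_tree_graph. Qed.
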